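(* Let $\lambda\in(0,1]$. For all terms $t,s\in\mathbb T$ and all $\varepsilon\in\mathbb Q_{\ge0}$: if $\vdash_\lambda t\equiv_\varepsilon s$ (derivable from the empty set of hypotheses), then $\mathbf d^\lambda(t,s)\le\varepsilon$.
   Context: Fix a countable set $\mathcal L$ of labels and a countable set $\mathcal X$ of names. $\mathcal D(S)$ is the set of finitely supported sub-probability distributions on $S$; $\mu(E)=\sum_{x\in E}\mu(x)$; $\mathbb 1_E$ is the indicator function of $E$. Terms: given a set $V$ of constants, $\mathbb T(V)$ is the set of terms generated by: each $v\in V$ and each name $X\in\mathcal X$ is a term; if $t,s$ are terms, $a\in\mathcal L$, $e\in[0,1]$, $X\in\mathcal X$, then $a.t$, $t+_es$, $\mu X.t$ are terms ($\mu X$ binds $X$; terms identified up to renaming of bound names; $t[s/X]$ is capture-avoiding substitution). $\mathbb T=\mathbb T(\emptyset)$. A name $X$ is guarded in $t$ if every free occurrence of $X$ lies inside a subterm $a.u$, or inside the right argument $u$ of a subterm $s+_1u$, or inside the left argument $u$ of a subterm $u+_0s$. Universal chain: $\tau_{\mathbb T}$ is the least function $\mathbb T\to[(\mathcal L\times\mathbb T)\uplus\mathcal X\to[0,1]]$ (pointwise order) with $\tau_{\mathbb T}(X)=\mathbb 1_{\{X\}}$, $\tau_{\mathbb T}(a.t)=\mathbb 1_{\{(a,t)\}}$, $\tau_{\mathbb T}(t+_es)=e\tau_{\mathbb T}(t)+(1-e)\tau_{\mathbb T}(s)$, $\tau_{\mathbb T}(\mu X.t)=\tau_{\mathbb T}(t[\mu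 X.t/X])$; each $\tau_{\mathbb T}(t)\in\mathcal D((\mathcal L\times\mathbb T)\uplus\mathcal X)$. Discounted distance: for a set $A$ with $1$-bounded pseudometric $\delta$ and finitely supported probability distributions $\mu,\nu$ on $A$, $K_\delta(\mu,\nu)=\min\{\sum_{x,y}\delta(x,y)\omega(x,y):\omega\text{ a coupling of }\mu,\nu\}$; for a sub-probability $\mu$, $\mu^*$ extends it to $A\uplus\{\bot\}$ with $\mu^*(\bot)=1-\mu(A)$. For a $1$-bounded pseudometric $d$ on $\mathbb T$, $\Lambda^\lambda(d)$ is the greatest $1$-bounded pseudometric on $((\mathcal L\times\mathbb T)\uplus\mathcal X)\uplus\{\bot\}$ with $\Lambda^\lambda(d)((a,t),(a,s))=\lambda\cdot d(t,s)$; $\Psi^\lambda(d)(t,s)=K_{\Lambda^\lambda(d)}(\tau_{\mathbb T}(t)^*,\tau_{\mathbb T}(s)^* )$; $\mathbf d^\lambda$ is the least fixed point of $\Psi^\lambda$ among $1$-bounded pseudometrics on $\mathbb T$ ordered pointwise. Deduction system: let $W$ be a countable set of metavariables. A quantitative equation is $t\equiv_\varepsilon s$ with $t,s\in\mathbb T(W)$, $\varepsilon\in\mathbb Q_{\ge0}$. A substitution $\sigma$ maps metavariables to terms of $\mathbb T(W)$, extended homomorphically. $\vdash_\lambda$ is the smallest relation between sets of quantitative equations and quantitative equations (write $\Gamma\vdash_\lambda\varphi$; $\vdash_\lambda\varphi$ for $\emptyset\vdash_\lambda\varphi$; $\Gamma\vdash_\lambda\Theta$ means $\Gamma\vdash_\lambda\varphi$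 for all $\varphi\in\Theta$) satisfying, for all terms $t,s,u,t',s'$ of $\mathbb T(W)$, names $X$, labels $a$, $e\in[0,1]$, rationals $\varepsilon,\varepsilon'\ge0$ (with $\vdash$ read as $\vdash_\lambda$): (Refl) $\vdash t\equiv_0t$; (Symm) $\{t\equiv_\varepsilon s\}\vdash s\equiv_\varepsilon t$; (Triang) $\{t\equiv_\varepsilon u,u\equiv_{\varepsilon'}s\}\vdash t\equiv_{\varepsilon+\varepsilon'}s$; (Max) $\{t\equiv_\varepsilon s\}\vdash t\equiv_{\varepsilon+\varepsilon'}s$ for $\varepsilon'>0$; (Arch) $\{t\equiv_{\varepsilon'}s\mid\varepsilon'>\varepsilon\}\vdash t\equiv_\varepsilon s$; (Subst) if $\Gamma\vdash t\equiv_\varepsilon s$ then $\sigma(\Gamma)\vdash\sigma(t)\equiv_\varepsilon\sigma(s)$; (Cut) if $\Gamma\vdash\Theta$ and $\Theta\vdash t\equiv_\varepsilon s$ then $\Gamma\vdash t\equiv_\varepsilon s$; (Assum) if $t\equiv_\varepsilon s\in\Gamma$ then $\Gamma\vdash t\equiv_\varepsilon s$; (B1) $\vdash t+_1s\equiv_0t$; (B2) $\vdash t+_et\equiv_0t$; (SC) $\vdash t+_es\equiv_0s+_{1-e}t$; (SA) $\vdash(t+_es)+_{e'}u\equiv_0t+_{ee'}(s+_{\frac{e'-ee'}{1-ee'}}u)$ for $e,e'\in[0,1)$; (Unfold) $\vdash\mu X.t\equiv_0t[\mu X.t/X]$; (Unguard) $\vdash\mu X.(t+_eX)\equiv_0\mu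 X.t$; (Fix) $\{s\equiv_0t[s/X]\}\vdash s\equiv_0\mu X.t$ when $X$ is guarded in $t$; (Cong) $\{t\equiv_0s\}\vdash\mu X.t\equiv_0\mu X.s$; (Top) $\vdash t\equiv_1s$; (Pref) $\{t\equiv_\varepsilon s\}\vdash a.t\equiv_\varepsilon a.s$; (IB) $\{t\equiv_\varepsilon s,t'\equiv_{\varepsilon'}s'\}\vdash t+_et'\equiv_{\varepsilon''}s+_es'$ for every rational $\varepsilon''\ge e\varepsilon+(1-e)\varepsilon'$; ($\lambda$-Pref) $\{t\equiv_\varepsilon s\}\vdash a.t\equiv_{\varepsilon'}a.s$ for every rational $\varepsilon'\ge\lambda\varepsilon$.
   Formalization: (Unguard) is taken only for e in (0,1], since at e=0 it is unsound (t=a.X gives distance 1); in (Subst) the terms σ(w) have no free names, as homomorphic extension modulo renaming requires; the set of names is infinite. *)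

(* Defs.v *)
From HB Require Import structures.
From mathcomp Require Import all_boot all_order all_algebra.
From mathcomp Require Import all_classical all_reals all_analysis.

Set Implicit Arguments.
Unset Strict Implicit.
Unset Printing Implicit Defensive.
Import Order.TTheory GRing.Theory Num.Theory.

Local Open Scope classical_set_scope.
Local Open Scope ring_scope.

(* [term R L V N] is the type of terms with labels in L, constants in V and
   free names in N, up to renaming of bound names: under the binder [Rec] the
   free names are those of [option N], where [None] is the bound name.  The
   named binder "mu X. t" is [mu X t] below.  When N is infinite every term is
   generated by [Cst], [Name], [Pref], [Sum] and [mu], and equality of terms is
   alpha-equivalence. *)
Inductive term (R : realType) (L V N : Type) : Type :=
| Cst of V
| Name of N
| Pref of L & term R L V N
| Sum of {i01 R} & term R L V N & term R L V N
| Rec of term R L V (option N).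

Arguments Cst {R L V N} v.
Arguments Name {R L V N} X.
Arguments Pref {R L V N} a t.
Arguments Sum {R L V N} e t s.
Arguments Rec {R L V N} t.

HB.instance Definition _ R L V N := gen_eqMixin (term R L V N).
HB.instance Definition _ R L V N := gen_choiceMixin (term R L V N).

Section Syntax.
Context {R : realType} {L : Type}.

Fixpoint rename {V N M : Type} (f : N -> M) (t : term R L V N) :
    term R L V M :=
  match t with
  | Cst v => Cst v
  | Name X => Name (f X)
  | Pref a t => Pref a (rename f t)
  | Sum e t s => Sum e (rename f t) (rename f s)
  | Rec t => Rec (rename (omap f) t)
  end.

(* Simultaneous substitution of terms for names.  It avoids capture: names of
   [f X] are shifted by [Some] under a binder. *)
Fixpoint bind {V N M : Type} (f : N -> term R L V M) (t : term R L V N) :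
    term R L V M :=
  match t with
  | Cst v => Cst v
  | Name X => f X
  | Pref a t => Pref a (bind f t)
  | Sum e t s => Sum e (bind f t) (bind f s)
  | Rec t =>
      Rec (bind (fun o => if o is Some X then rename some (f X)
                          else Name None) t)
  end.

Fixpoint map_cst {V V' N : Type} (f : V -> V') (t : term R L V N) :
    term R L V' N :=
  match t with
  | Cst v => Cst (f v)
  | Name X => Name X
  | Pref a t => Pref a (map_cst f t)
  | Sum e t s => Sum e (map_cst f t) (map_cst f s)
  | Rec t => Rec (map_cst f t)
  end.

Definition mu {V : Type} {N : eqType} (X : N) (t : term R L V N) :
    term R L V N :=
  Rec (rename (fun Y => if Y == X then None else Some Y) t).

(* t[s/X] *)
Definition subst {V : Type} {N : eqType} (t : term R L V N) (X : N)
    (s : term R L V N) : term R L V N :=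
  bind (fun Y => if Y == X then s else Name Y) t.

Fixpoint guarded {V N : Type} (X : N) (t : term R L V N) : Prop :=
  match t with
  | Cst _ => True
  | Name Y => Y <> X
  | Pref _ _ => True
  | Sum e t s => (e%:num = 0 \/ guarded X t) /\ (e%:num = 1 \/ guarded X s)
  | Rec t => guarded (Some X) t
  end.

End Syntax.

Section Extremal.
Context {R : realType} {A B : Type}.
Implicit Types (f g : A -> B -> R) (S : set (A -> B -> R)).

Definition le_pointwise f g := forall x y, f x y <= g x y.

(* The least and greatest elements of S (the zero function if S has none). *)
Definition least_of S : A -> B -> R :=
  xget (fun _ _ => 0) [set f | S f /\ forall g, S g -> le_pointwise f g].

Definition greatest_of S : A -> B -> R :=
  xget (fun _ _ => 0) [set f | S f /\ forall g, S g -> le_pointwise g f].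

End Extremal.

Section Kantorovich.
Context {R : realType}.

Record pseudometric1 {A : Type} (d : A -> A -> R) : Prop := Pseudometric1 {
  pm_refl : forall x, d x x = 0;
  pm_sym : forall x y, d x y = d y x;
  pm_triangle : forall x y z, d x z <= d x y + d y z;
  pm_bounds : forall x y, 0 <= d x y <= 1 }.

Definition mass {A : choiceType} (m : A -> R) : R := \sum_(x \in [set: A]) m x.

Record fin_prob {A : choiceType} (m : A -> R) : Prop := FinProb {
  fp_support : finite_set [set x | m x != 0];
  fp_ge0 : forall x, 0 <= m x;
  fp_mass : mass m = 1 }.

Definition coupling {A : choiceType} (m n : A -> R) (w : A * A -> R) : Prop :=
  [/\ fin_prob w,
      forall x, \sum_(y \in [set: A]) w (x, y) = m x
    & forall y, \sum_(x \in [set: A]) w (x, y) = n y].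

(* For finitely supported probabilities m, n this infimum is attained. *)
Definition kantorovich {A : choiceType} (d : A -> A -> R) (m n : A -> R) : R :=
  inf [set \sum_(p \in [set: A * A]) d p.1 p.2 * w p | w in coupling m n].

(* mu^*, with bottom encoded as [None] *)
Definition star {A : choiceType} (m : A -> R) (x : option A) : R :=
  if x is Some y then m y else 1 - mass m.

End Kantorovich.

Section UniversalChain.
Context {R : realType} {L X : countType}.
Local Notation T := (term R L void X).
Local Notation A := (L * T + X)%type.

Record chain_eqs (tau : T -> A -> R) : Prop := ChainEqs {
  chain_bounds : forall t x, 0 <= tau t x <= 1;
  chain_name : forall Y, tau (Name Y) = \1_[set inr Y];
  chain_pref : forall a t, tau (Pref a t) = \1_[set inl (a, t)];
  chain_sum : forall e t s x,
    tau (Sum e t s) x = e%:num * tau t x + (1 - e%:num) * tau s x;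
  chain_mu : forall Y t, tau (mu Y t) = tau (subst t Y (mu Y t)) }.

Definition universal_chain : T -> A -> R := least_of chain_eqs.

Definition Lambda (lam : R) (d : T -> T -> R) : option A -> option A -> R :=
  greatest_of [set m | pseudometric1 m /\
    forall a t s, m (Some (inl (a, t))) (Some (inl (a, s))) = lam * d t s].

Definition Psi (lam : R) (d : T -> T -> R) (t s : T) : R :=
  kantorovich (Lambda lam d)
    (star (universal_chain t)) (star (universal_chain s)).

Definition discounted_distance (lam : R) : T -> T -> R :=
  least_of [set d | pseudometric1 d /\ Psi lam d = d].

End UniversalChain.

Record qeq (R : realType) (L W X : Type) : Type := QEq {
  qlhs : term R L W X;
  qerr : {nonneg rat};
  qrhs : term R L W X }.

Notation "t =[ eps ]= s" := (QEq t eps s)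
  (at level 70, eps at level 60, no associativity).

Section Deduction.
Context {R : realType} {L X W : countType}.
Local Notation T := (term R L W X).
Local Notation Q := (qeq R L W X).

(* [h] is the homomorphic extension to T of [sigma : W -> T].  As terms are
   identified up to renaming of bound names and there are infinitely many
   names, sigma has such an extension exactly when no name is free in any
   sigma w: otherwise h (mu X. w) = mu X. (sigma w) depends on the choice of
   the bound name X. *)
Record hom_extension (sigma : W -> T) (h : T -> T) : Prop := HomExtension {
  hom_cst : forall w, h (Cst w) = sigma w;
  hom_name : forall Y, h (Name Y) = Name Y;
  hom_pref : forall a t, h (Pref a t) = Pref a (h t);
  hom_sum : forall e t s, h (Sum e t s) = Sum e (h t) (h s);
  hom_mu : forall Y t, h (mu Y t) = mu Y (h t) }.

Definition map_qeq (h : T -> T) (q : Q) : Q :=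
  h (qlhs q) =[ qerr q ]= h (qrhs q).

Inductive derives (lam : R) : set Q -> Q -> Prop :=
| d_Refl t : derives lam set0 (t =[ 0%:nng ]= t)
| d_Symm t s eps : derives lam [set t =[ eps ]= s] (s =[ eps ]= t)
| d_Triang t u s eps eps' :
    derives lam [set t =[ eps ]= u; u =[ eps' ]= s]
      (t =[ (eps%:num + eps'%:num)%:nng ]= s)
| d_Max t s eps (eps' : {nonneg rat}) : 0 < eps'%:num ->
    derives lam [set t =[ eps ]= s] (t =[ (eps%:num + eps'%:num)%:nng ]= s)
| d_Arch t s (eps : {nonneg rat}) :
    derives lam [set t =[ eps' ]= s | eps' in
                   [set eps' : {nonneg rat} | eps%:num < eps'%:num]]
      (t =[ eps ]= s)
| d_Subst sigma h Gamma q : hom_extension sigma h ->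
    derives lam Gamma q -> derives lam (map_qeq h @` Gamma) (map_qeq h q)
| d_Cut (Gamma Theta : set Q) q :
    (forall r, Theta r -> derives lam Gamma r) ->
    derives lam Theta q -> derives lam Gamma q
| d_Assum (Gamma : set Q) q : Gamma q -> derives lam Gamma q
| d_B1 t s : derives lam set0 (Sum 1%:i01 t s =[ 0%:nng ]= t)
| d_B2 e t : derives lam set0 (Sum e t t =[ 0%:nng ]= t)
| d_SC e t s :
    derives lam set0 (Sum e t s =[ 0%:nng ]= Sum (1 - e%:num)%:i01 s t)
| d_SA (e e' f : {i01 R}) t s u : e%:num < 1 -> e'%:num < 1 ->
    f%:num = (e'%:num - e%:num * e'%:num) / (1 - e%:num * e'%:num) ->
    derives lam set0 (Sum e' (Sum e t s) u
      =[ 0%:nng ]= Sum (e%:num * e'%:num)%:i01 t (Sum f s u))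
| d_Unfold Y t : derives lam set0 (mu Y t =[ 0%:nng ]= subst t Y (mu Y t))
(* Unsound for e = 0: mu X. (t +_0 X) has the empty transition distribution
   of mu X. X, whatever t is. *)
| d_Unguard Y (e : {i01 R}) t : 0 < e%:num ->
    derives lam set0 (mu Y (Sum e t (Name Y)) =[ 0%:nng ]= mu Y t)
| d_Fix Y t s : guarded Y t ->
    derives lam [set s =[ 0%:nng ]= subst t Y s] (s =[ 0%:nng ]= mu Y t)
| d_Cong Y t s :
    derives lam [set t =[ 0%:nng ]= s] (mu Y t =[ 0%:nng ]= mu Y s)
| d_Top t s : derives lam set0 (t =[ 1%:nng ]= s)
| d_Pref a t s eps :
    derives lam [set t =[ eps ]= s] (Pref a t =[ eps ]= Pref a s)
| d_IB (e : {i01 R}) t s t' s' (eps eps' eps'' : {nonneg rat}) :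
    e%:num * ratr eps%:num + (1 - e%:num) * ratr eps'%:num
      <= ratr eps''%:num ->
    derives lam [set t =[ eps ]= s; t' =[ eps' ]= s']
      (Sum e t t' =[ eps'' ]= Sum e s s')
| d_LamPref a t s (eps eps' : {nonneg rat}) :
    lam * ratr eps%:num <= ratr eps'%:num ->
    derives lam [set t =[ eps ]= s] (Pref a t =[ eps' ]= Pref a s).

End Deduction.

(* Main.v *)
Require Import Defs.
From mathcomp Require Import all_boot all_order all_algebra.
From mathcomp Require Import all_classical all_reals all_analysis.
From mathcomp Require Import ring lra.

Set Implicit Arguments.
Unset Strict Implicit.
Unset Printing Implicit Defensive.
Import Order.TTheory GRing.Theory Num.Theory.

Local Open Scope classical_set_scope.
Local Open Scope ring_scope.

(* Integration against tau(t) has a structural description, since the least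
   solution of v = r + p v is r / (1 - p), or 0 if p = 1; with the substitution
   lemma for this integral no further induction on the fixed point tau is
   needed.

   (Pref), (IB) and (lambda-Pref) are estimates for couplings.  The rules about
   mu only involve distance 0.  Terms at distance 0 integrate alike every
   function that is constant on pairs at distance 0: supports are finite, so a
   coupling of small cost has little mass on pairs at positive distance.
   Conversely, let E be a relation such that related terms integrate alike all
   functions respecting both E and the kernel of the distance.  Then E is
   contained in the kernel, because the 0-1 pseudometric of the equivalence
   generated by both is a prefixed point of Psi.  For two candidate solutions
   m, m' this is applied to E = {(u[m/X], u[m'/X]) | u a term}. *)

(** * Renaming, substitution and fresh names *)

Section SyntaxTheory.
Context {R : realType} {L V : Type}.

(** It instantiates the bound name [None]: [bind (plug (Rec t)) t] is the unfolding of [Rec t]. *)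
Definition plug {N : Type} (s : term R L V N) (o : option N) : term R L V N :=
  if o is Some Y then Name Y else s.

Lemma rename_comp {N M P} (g : M -> P) (f : N -> M) (t : term R L V N) :
  rename g (rename f t) = rename (g \o f) t.
Proof.
elim: t M P g f => {N} [N v|N Y|N a t IH|N e t IHt s IHs|N t IH] M P g f //=.
- by rewrite IH.
- by rewrite IHt IHs.
- by rewrite IH; congr (Rec (rename _ t)); apply/funext => -[].
Qed.

Lemma bind_rename {N M P} (g : M -> term R L V P) (f : N -> M)
    (t : term R L V N) : bind g (rename f t) = bind (g \o f) t.
Proof.
elim: t M P g f => {N} [N v|N Y|N a t IH|N e t IHt s IHs|N t IH] M P g f //=.
- by rewrite IH.
- by rewrite IHt IHs.
- by rewrite IH; congr (Rec (bind _ t)); apply/funext => -[].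
Qed.

Lemma rename_bind {N M P} (g : M -> P) (f : N -> term R L V M)
    (t : term R L V N) : rename g (bind f t) = bind (rename g \o f) t.
Proof.
elim: t M P g f => {N} [N v|N Y|N a t IH|N e t IHt s IHs|N t IH] M P g f //=.
- by rewrite IH.
- by rewrite IHt IHs.
- rewrite IH; congr (Rec (bind _ t)); apply/funext => -[Y|] //=.
  by rewrite !rename_comp; congr (rename _ _); apply/funext.
Qed.

Lemma bind_bind {N M P} (g : M -> term R L V P) (f : N -> term R L V M)
    (t : term R L V N) : bind g (bind f t) = bind (bind g \o f) t.
Proof.
elim: t M P g f => {N} [N v|N Y|N a t IH|N e t IHt s IHs|N t IH] M P g f //=.
- by rewrite IH.
- by rewrite IHt IHs.
- rewrite IH; congr (Rec (bind _ t)); apply/funext => -[Y|] //=.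
  by rewrite rename_bind bind_rename; congr (bind _ _); apply/funext.
Qed.

Lemma bind_Name {N} (t : term R L V N) : bind Name t = t.
Proof.
elim: t => {N} [N v|N Y|N a t IH|N e t IHt s IHs|N t IH] //=.
- by rewrite IH.
- by rewrite IHt IHs.
- by rewrite -[in RHS]IH; congr (Rec (bind _ t)); apply/funext => -[].
Qed.

Fixpoint fresh {N : Type} (Y : N) (t : term R L V N) : Prop :=
  match t with
  | Cst _ => True
  | Name Z => Z <> Y
  | Pref _ t => fresh Y t
  | Sum _ t s => fresh Y t /\ fresh Y s
  | Rec t => fresh (Some Y) t
  end.

Lemma finite_not_fresh {N} (t : term R L V N) :
  finite_set [set Y | ~ fresh Y t].
Proof.
elim: t => {N} [N v|N Y|N a t IH|N e t IHt s IHs|N t IH] //=.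
- apply: (@sub_finite_set _ _ [set Y]) => // Z /= /contrapT ->; exact: erefl.
- apply: (@sub_finite_set _ _ ([set Y | ~ fresh Y t] `|` [set Y | ~ fresh Y s])).
    by move=> Z /= /not_andP.
  by rewrite finite_setU.
- by apply: (@finite_preimage _ _ _ some _ IH) => Y Z _ _ [].
Qed.

Lemma eq_rename {N M} (f g : N -> M) (t : term R L V N) :
  (forall Y, ~ fresh Y t -> f Y = g Y) -> rename f t = rename g t.
Proof.
elim: t M f g => {N} [N v|N Y|N a t IH|N e t IHt s IHs|N t IH] M f g //= fg.
- by rewrite fg //; apply.
- by rewrite (IH _ f g).
- by rewrite (IHt _ f g) ?(IHs _ f g) // => Y hY; apply: fg => -[].
- by rewrite (IH _ (omap f) (omap g)) // => -[Y|] //= /fg ->.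
Qed.

Lemma rename_id {N} (t : term R L V N) : rename id t = t.
Proof.
elim: t => {N} [N v|N Y|N a t IH|N e t IHt s IHs|N t IH] //=.
- by rewrite IH.
- by rewrite IHt IHs.
- by rewrite -[in RHS]IH; congr (Rec (rename _ t)); apply/funext => -[].
Qed.

Lemma fresh_rename {N M} (f : N -> M) Z (t : term R L V N) :
  fresh Z (rename f t) <-> forall Y, f Y = Z -> fresh Y t.
Proof.
elim: t M f Z => {N} [N v|N Y|N a t IH|N e t IHt s IHs|N t IH] M f Z //=.
- by split=> [YZ Y' Y'Z YY'|h YZ]; [apply: YZ; rewrite YY'|apply: h YZ _].
- rewrite IHt IHs; split=> [[h1 h2] Y YZ|h]; first by split; auto.
  by split=> Y /h [].
- rewrite IH; split=> [h Y YZ|h [Y|] //= [/h]//].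
  by apply: h => /=; rewrite YZ.
Qed.

(** Applied to the map from the empty type of names, it turns a term in which no name is free into a
    closed one. *)
Lemma rename_preimage {N M} (g : N -> M) (t : term R L V M) :
  (forall Y, ~ fresh Y t -> exists Z, g Z = Y) -> exists t', rename g t' = t.
Proof.
elim: t N g => {M} [M v|M Y|M a t IH|M e t IHt s IHs|M t IH] N g /= h.
- by exists (Cst v).
- by have [|Z ZY] := h Y; [apply|exists (Name Z); rewrite /= ZY].
- by have [t' <-] := IH _ _ h; exists (Pref a t').
- have [|t' <-] := IHt _ g; first by move=> Y hY; apply: h => -[].
  have [|s' <-] := IHs _ g; first by move=> Y hY; apply: h => -[].
  by exists (Sum e t' s').
- have [|t' <-] := IH _ (omap g); last by exists (Rec t').
  by move=> [Y|] hY; [have [Z <-] := h _ hY; exists (Some Z)|exists None].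
Qed.

(** The equations for chains and for homomorphisms are stated for [mu], whereas induction on terms
    meets [Rec]. The bound name is called [Y], fresh for [Rec t], so that [mu Y] undoes the renaming
    [odflt Y]. *)
Lemma Rec_mu {N : eqType} (N_infinite : infinite_set [set: N])
    (t : term R L V (option N)) :
  exists Y f, mu Y (rename f t) = Rec t.
Proof.
have fin : finite_set [set Y | ~ fresh Y (Rec t)] by exact: finite_not_fresh.
have [Y _ Yt] : exists2 Y, [set: N] Y & ~ [set Y | ~ fresh Y (Rec t)] Y.
  apply: contrapT => h; apply: N_infinite.
  apply: sub_finite_set fin => Y _; apply: contrapT => hY; apply: h.
  by exists Y.
move/contrapT: Yt => /= Yt.
exists Y, (odflt Y).
rewrite /mu rename_comp; congr Rec; rewrite -[RHS]rename_id.
apply: eq_rename => -[Z|] hZ /=; last by rewrite eqxx.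
by case: eqP => // ZY; rewrite ZY in hZ.
Qed.

Lemma subst_muE {N : eqType} Y (t : term R L V N) :
  subst t Y (mu Y t) =
  bind (plug (mu Y t)) (rename (fun Z => if Z == Y then None else Some Z) t).
Proof.
rewrite /subst /= bind_rename; congr bind; apply/funext => Z /=.
by case: eqP.
Qed.

End SyntaxTheory.

(** * Finitely supported measures as lists of weighted points *)

Section Integration.
Context {R : realType}.

(** Points may repeat in a list, so sums and images of measures are plain [cat] and [map]; measures
    are compared through integrals. *)
Definition integ {B : Type} (l : seq (R * B)) (f : B -> R) : R :=
  \sum_(p <- l) p.1 * f p.2.

Definition nneg {B : Type} (l : seq (R * B)) : Prop := all (fun p => 0 <= p.1) l.

Definition wmap {B C : Type} (c : R) (f : B -> C) (l : seq (R * B)) : seq (R * C) :=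
  [seq (c * p.1, f p.2) | p <- l].

Lemma integ_nil {B} (f : B -> R) : integ [::] f = 0.
Proof. by rewrite /integ big_nil. Qed.

Lemma integ_cons {B} p l (f : B -> R) :
  integ (p :: l) f = p.1 * f p.2 + integ l f.
Proof. by rewrite /integ big_cons. Qed.

Lemma integ_cat {B} l1 l2 (f : B -> R) :
  integ (l1 ++ l2) f = integ l1 f + integ l2 f.
Proof. by rewrite /integ big_cat. Qed.

Lemma integ_wmap {B C} c (g : B -> C) l f :
  integ (wmap c g l) f = c * integ l (f \o g).
Proof.
rewrite /integ /wmap big_map mulr_sumr.
by apply: eq_bigr => p _; rewrite mulrA.
Qed.

Lemma integD {B} l (f g : B -> R) :
  integ l (fun x => f x + g x) = integ l f + integ l g.
Proof.
by rewrite /integ -big_split; apply: eq_bigr => p _; rewrite /= mulrDr.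
Qed.

Lemma integZ {B} l c (f : B -> R) :
  integ l (fun x => c * f x) = c * integ l f.
Proof.
by rewrite /integ mulr_sumr; apply: eq_bigr => p _; rewrite mulrCA.
Qed.

Lemma integB {B} l (f g : B -> R) :
  integ l (fun x => f x - g x) = integ l f - integ l g.
Proof.
by rewrite /integ -sumrB; apply: eq_bigr => p _; rewrite /= mulrBr.
Qed.

Lemma integ_le {B} l (f g : B -> R) : nneg l -> (forall x, f x <= g x) ->
  integ l f <= integ l g.
Proof.
move=> + fg; elim: l => [|p l IH]; first by rewrite !integ_nil.
by rewrite !integ_cons => /andP[p0 /IH]; apply: lerD; rewrite ler_wpM2l.
Qed.

Lemma integ_ge0 {B} l (f : B -> R) : nneg l -> (forall x, 0 <= f x) ->
  0 <= integ l f.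
Proof.
move=> + f0; elim: l => [|p l IH]; first by rewrite integ_nil.
by rewrite integ_cons => /andP[p0 /IH]; apply: addr_ge0; rewrite mulr_ge0.
Qed.

Lemma integ_eq0 {B} l (f g : B -> R) : nneg l -> (forall x, 0 <= f x) ->
  (forall x, f x = 0 -> g x = 0) -> integ l f <= 0 -> integ l g = 0.
Proof.
move=> + f0 fg; elim: l => [|p l IH]; first by rewrite !integ_nil.
rewrite !integ_cons => /andP[p0 l0] le0.
have pf0 : 0 <= p.1 * f p.2 by apply: mulr_ge0.
have lf0 : 0 <= integ l f by apply: integ_ge0.
rewrite (IH l0) ?addr0; last by lra.
have /eqP : p.1 * f p.2 = 0 by lra.
by rewrite mulf_eq0 => /orP[/eqP ->|/eqP /fg ->]; rewrite ?mul0r ?mulr0.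
Qed.

Lemma nneg_wmap {B C} c (g : B -> C) l : 0 <= c -> nneg l -> nneg (wmap c g l).
Proof.
by move=> c0; rewrite /nneg all_map; apply: sub_all => p /= p0; apply: mulr_ge0.
Qed.

Lemma nneg_cat {B} (l1 l2 : seq (R * B)) : nneg l1 -> nneg l2 -> nneg (l1 ++ l2).
Proof. by rewrite /nneg all_cat => -> ->. Qed.

Definition at_point {B : eqType} (x y : B) : R := (y == x)%:R.

Lemma at_point_bounds {B : eqType} (x y : B) : 0 <= at_point x y <= 1.
Proof. by rewrite /at_point; case: eqP; rewrite ?lexx ler01. Qed.

End Integration.

(** * Transition integrals by structural recursion, and the substitution lemma *)

Section Transitions.
Context {R : realType} {L V : Type}.

Definition succ (N : Type) : Type := (L * term R L V N + N)%type.

Definition at_bound {N : Type} (x : succ (option N)) : R :=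
  if x is inr None then 1 else 0.

(** Integrand for the body of [Rec t]: successors receive the unfolding, and the bound name gets 0
    because the factor in [ev] accounts for looping through it. *)
Definition close_rec {N : Type} (t : term R L V (option N)) (phi : succ N -> R)
    (x : succ (option N)) : R :=
  match x with
  | inl (a, u) => phi (inl (a, bind (plug (Rec t)) u))
  | inr (Some Y) => phi (inr Y)
  | inr None => 0
  end.

(* [ev t phi] is the integral of phi against the transition distribution of t.
   The least solution v of v = r + p v, where p is the mass of the bound name,
   is r / (1 - p) if p < 1 and 0 if p = 1; since 0^-1 = 0 the formula for
   [Rec] covers both cases. *)
Fixpoint ev {N : Type} (t : term R L V N) : (succ N -> R) -> R :=
  match t with
  | Cst _ => fun=> 0
  | Name Y => fun phi => phi (inr Y)
  | Pref a t => fun phi => phi (inl (a, t))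
  | Sum e t s => fun phi => e%:num * ev t phi + (1 - e%:num) * ev s phi
  | Rec t => fun phi => (1 - ev t at_bound)^-1 * ev t (close_rec t phi)
  end.

(** For [Rec t], the entries at the bound name are deleted, the other successors closed, and the
    weights rescaled by [(1 - p)^-1]; the remaining mass, at most [1 - p], becomes at most 1.
    Linearity and monotonicity of [ev t] then come from finite sums. *)
Lemma ev_rep {N} (t : term R L V N) : exists l : seq (R * succ N),
  [/\ nneg l, integ l (fun=> 1) <= 1 & ev t = integ l].
Proof.
elim: t => {N} [N v|N Y|N a t IH|N e t IHt s IHs|N t IH] /=.
- exists [::]; split=> //; first by rewrite integ_nil.
  by apply/funext => f; rewrite integ_nil.
- exists [:: (1, inr Y)]; split=> //; first by rewrite /nneg /= ler01.
    by rewrite integ_cons integ_nil mul1r addr0.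
  by apply/funext => f; rewrite integ_cons integ_nil mul1r addr0.
- exists [:: (1, inl (a, t))]; split=> //; first by rewrite /nneg /= ler01.
    by rewrite integ_cons integ_nil mul1r addr0.
  by apply/funext => f; rewrite integ_cons integ_nil mul1r addr0.
- have [l1 [l10 l11 ->]] := IHt; have [l2 [l20 l21 ->]] := IHs.
  have e0 : 0 <= e%:num by [].
  have e1 : e%:num <= 1 by [].
  exists (wmap e%:num id l1 ++ wmap (1 - e%:num) id l2); split.
  + by apply: nneg_cat; apply: nneg_wmap => //; rewrite subr_ge0.
  + rewrite integ_cat !integ_wmap; set x := integ _ _; set y := integ _ _.
    have {}l11 : x <= 1 by []. have {}l21 : y <= 1 by [].
    nra.
  + by apply/funext => f; rewrite integ_cat !integ_wmap.
- have [l [l0 l1 ->]] := IH; set p := integ l at_bound.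
  have p1 : p <= 1.
    by apply: le_trans l1; apply: integ_le => // -[[a u]|[Y|]] //=.
  have c0 : 0 <= (1 - p)^-1 by rewrite invr_ge0 subr_ge0.
  pose g (x : succ (option N)) : option (succ N) := match x with
    | inl (a, u) => Some (inl (a, bind (plug (Rec t)) u))
    | inr (Some Y) => Some (inr Y) | inr None => None end.
  pose h (q : R * succ (option N)) := omap (pair ((1 - p)^-1 * q.1)) (g q.2).
  have hE f : integ (pmap h l) f =
      (1 - p)^-1 * integ l (fun x => oapp f 0 (g x)).
    rewrite /integ big_pmap mulr_sumr; apply: eq_bigr => -[w x] _ /=.
    by rewrite /h /=; case: (g x) => [y|] /=; rewrite ?mulr0 ?mulrA.
  exists (pmap h l); split.
  + elim: (l) l0 => //= -[w x] l' IHl /andP[w0 l'0] /=.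
    case hx : (h (w, x)) => [q|] /=; last exact: IHl.
    move: hx; rewrite /h /=; case: (g x) => //= y [<-] /=.
    by apply/andP; split; [apply: mulr_ge0|apply: IHl].
  + rewrite hE; have -> : integ l (fun x => oapp (fun=> 1) 0 (g x)) =
        integ l (fun=> 1) - p.
      rewrite -integB; congr (integ l _); apply/funext.
      by move=> [[a u]|[Y|]] /=; rewrite ?subr0 ?subrr.
    have [->|p1'] := eqVneq p 1; first by rewrite subrr invr0 mul0r ler01.
    have p1'' : 0 < 1 - p by rewrite subr_gt0 lt_neqAle p1' p1.
    by rewrite mulrC ler_pdivrMr // mul1r lerD2r.
  + apply/funext => f; rewrite hE; congr (_ * integ l _); apply/funext.
    by move=> [[a u]|[Y|]].
Qed.

Lemma evD {N} (t : term R L V N) f g :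
  ev t (fun x => f x + g x) = ev t f + ev t g.
Proof. by have [l [_ _ ->]] := ev_rep t; rewrite integD. Qed.

Lemma evZ {N} (t : term R L V N) c f : ev t (fun x => c * f x) = c * ev t f.
Proof. by have [l [_ _ ->]] := ev_rep t; rewrite integZ. Qed.

Lemma ev_le {N} (t : term R L V N) f g :
  (forall x, f x <= g x) -> ev t f <= ev t g.
Proof. by have [l [? _ ->]] := ev_rep t; apply: integ_le. Qed.

Lemma ev_le1 {N} (t : term R L V N) f : (forall x, f x <= 1) -> ev t f <= 1.
Proof.
have [l [? l1 ->]] := ev_rep t => f1.
by apply: le_trans l1; apply: integ_le.
Qed.

Lemma ev0 {N} (t : term R L V N) : ev t (fun=> 0) = 0.
Proof. by have := evZ t 0 (fun=> 0); rewrite !mul0r. Qed.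

Lemma ev_ge0 {N} (t : term R L V N) f : (forall x, 0 <= f x) -> 0 <= ev t f.
Proof. by move=> f0; rewrite -(ev0 t); apply: ev_le. Qed.

Lemma at_bound_le1 {N} (x : succ (option N)) : at_bound x <= 1.
Proof. by case: x => [[]|[]] //=. Qed.

Definition bind_succ {N M : Type} (f : N -> term R L V M) (phi : succ M -> R)
    (x : succ N) : R :=
  match x with
  | inl (a, u) => phi (inl (a, bind f u))
  | inr Y => ev (f Y) phi
  end.

Lemma rename_bindE {N M} (g : N -> M) (t : term R L V N) :
  rename g t = bind (Name \o g) t.
Proof. by rewrite -bind_rename bind_Name. Qed.

(** Renaming precedes substitution, because [bind] shifts the substituted terms by [rename some]
    under a binder. *)
Lemma ev_rename {N M} (g : N -> M) (t : term R L V N) phi :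
  ev (rename g t) phi = ev t (bind_succ (Name \o g) phi).
Proof.
elim: t M g phi => {N} [N v|N Y|N a t IH|N e t IHt s IHs|N t IH] M g phi //=.
- by rewrite rename_bindE.
- by rewrite IHt IHs.
- rewrite !IH; congr ((1 - ev t _)^-1 * ev t _); apply/funext => -[[a u]|[Y|]] //=.
  rewrite !bind_bind; congr (phi (inl (a, bind _ u))).
  apply/funext => -[Y|] //=; rewrite rename_bindE.
  by congr (Rec (bind _ t)); apply/funext => -[].
Qed.

(** A free name of [t] hands over to the transitions of the term put in its place. Under a binder
    the shifted terms put no mass on the bound name, so the factor [(1 - p)^-1] is unchanged. *)
Lemma ev_bind {N M} (f : N -> term R L V M) (t : term R L V N) phi :
  ev (bind f t) phi = ev t (bind_succ f phi).
Proof.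
elim: t M f phi => {N} [N v|N Y|N a t IH|N e t IHt s IHs|N t IH] M f phi //=.
- by rewrite IHt IHs.
- rewrite !IH; congr ((1 - ev t _)^-1 * ev t _); apply/funext => -[[a u]|[Y|]] //=.
  + rewrite ev_rename -[RHS](ev0 (f Y)); congr ev.
    by apply/funext => -[[a u]|Z].
  + rewrite !bind_bind; congr (phi (inl (a, bind _ u))).
    apply/funext => -[Y|] //=; rewrite bind_rename -[RHS]bind_Name.
    by congr bind; apply/funext.
  + rewrite ev_rename; congr ev; apply/funext => -[[a u]|Z] //=.
    by rewrite bind_bind bind_Name.
Qed.

(** Plugging [Rec t] for the bound name gives [r + p v] with [v = r / (1 - p)], which is again [v]
    if [p] is not 1. *)
Lemma ev_Rec {N} (t : term R L V (option N)) phi :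
  ev (bind (plug (Rec t)) t) phi = ev (Rec t) phi.
Proof.
rewrite ev_bind.
have -> : bind_succ (plug (Rec t)) phi =
    (fun x => close_rec t phi x + ev (Rec t) phi * at_bound x).
  by apply/funext => -[[a u]|[Y|]] /=; rewrite ?mulr0 ?addr0 ?mulr1 ?add0r.
rewrite evD evZ /=.
have p1 : ev t at_bound <= 1 by apply: ev_le1; exact: at_bound_le1.
set r := ev t (close_rec t phi); set p := ev t at_bound in p1 *.
have [p1'|p1'] := eqVneq p 1; last first.
  by field; rewrite subr_eq0 eq_sym.
(* For [p = 1] one has [v = 0], and [r = 0] as well: the integral of [1 - at_bound] is at most 0, so
   all the mass sits at the bound name. *)
rewrite p1' subrr invr0 mul0r mul0r addr0 {}/r.
have [l [l0 l1 El]] := ev_rep t.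
rewrite El; apply: (integ_eq0 (f := fun x => 1 - at_bound x) l0).
- by move=> x; rewrite subr_ge0 at_bound_le1.
- by move=> [[a u]|[Y|]] //= /eqP; rewrite subr0 oner_eq0.
- by move: p1'; rewrite /p El => p1'; rewrite integB p1' subr_le0.
Qed.

End Transitions.

(** * Least and greatest elements in the pointwise order *)

Section ExtremalTheory.
Context {R : realType} {A B : Type}.
Implicit Types (f : A -> B -> R) (S : set (A -> B -> R)).

Lemma le_pointwise_anti f g : le_pointwise f g -> le_pointwise g f -> f = g.
Proof.
move=> fg gf; apply/funext => x; apply/funext => y.
by apply/eqP; rewrite eq_le fg gf.
Qed.

Lemma least_ofE S f :
  S f -> (forall g, S g -> le_pointwise f g) -> least_of S = f.
Proof.
move=> Sf fmin; rewrite /least_of; case: xgetP => [g _ [Sg gmin]|/(_ f) []//].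
by apply: le_pointwise_anti; [apply: gmin|apply: fmin].
Qed.

Lemma greatest_ofE S f :
  S f -> (forall g, S g -> le_pointwise g f) -> greatest_of S = f.
Proof.
move=> Sf fmax; rewrite /greatest_of; case: xgetP => [g _ [Sg gmax]|/(_ f) []//].
by apply: le_pointwise_anti; [apply: fmax|apply: gmax].
Qed.

End ExtremalTheory.

(** * Identification of the universal chain with the structural integral *)

Section UniversalChainTheory.
Context {R : realType} {L X : countType} (X_infinite : infinite_set [set: X]).
Local Notation T := (term R L void X).
Local Notation A := (L * T + X)%type.

Lemma chain_Rec (tau : T -> A -> R) t : chain_eqs tau ->
  tau (Rec t) = tau (bind (plug (Rec t)) t).
Proof.
move=> tauP; have [Y [f]] := Rec_mu X_infinite t; rewrite /mu => -[<-].
by have := chain_mu tauP Y (rename f t); rewrite subst_muE.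
Qed.

Lemma indic_set1 {B : choiceType} (x y : B) : \1_[set x] y = (y == x)%:R :> R.
Proof. by rewrite indicE; congr ((nat_of_bool _)%:R); apply/idP/eqP; rewrite in_setE. Qed.

Lemma ev_chain : chain_eqs (fun (t : T) (x : A) => ev t (at_point x)).
Proof.
split=> [t x|Y|a t|e t s x|Y t] //.
- have h := @at_point_bounds R _ x.
  by rewrite ev_ge0 ?ev_le1 // => y; have /andP[] := h y.
- by apply/funext => x; rewrite indic_set1 /= /at_point eq_sym.
- by apply/funext => x; rewrite indic_set1 /= /at_point eq_sym.
- by apply/funext => x; rewrite subst_muE; apply/esym/ev_Rec.
Qed.

(** Minimality of [ev] among solutions, stated with a substitution [f] so that induction passes
    under binders. For [Rec t], the value [v] of [tau] satisfies [r + p v <= v], whence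
    [r / (1 - p) <= v] if [p < 1]; if [p = 1] nonnegativity of [tau] suffices. *)
Lemma chain_ge (tau : T -> A -> R) : chain_eqs tau ->
  forall N (t : term R L void N) (f : N -> T) x,
  ev t (fun y => match y with inl (a, u) => at_point x (inl (a, bind f u))
                 | inr Y => tau (f Y) x end) <= tau (bind f t) x.
Proof.
move=> tauP N t.
elim: t => {N} [N v|N Y|N a t IH|N e t IHt s IHs|N t IH] f x //=.
- by rewrite (chain_pref tauP) indic_set1 /at_point eq_sym.
- by rewrite (chain_sum tauP) lerD // ler_wpM2l ?subr_ge0 //.
- set f' := (X in bind X t).
  have tau0 : 0 <= tau (Rec (bind f' t)) x.
    by have /andP[] := chain_bounds tauP (Rec (bind f' t)) x.
  have p1 : ev t at_bound <= 1 by apply: ev_le1; exact: at_bound_le1.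
  have [->|p1'] := eqVneq (ev t at_bound) 1.
    by rewrite subrr invr0 mul0r.
  have {p1 p1'} p1 : 0 < 1 - ev t at_bound by rewrite subr_gt0 lt_neqAle p1' p1.
  rewrite mulrC ler_pdivrMr // mulrBr mulr1 lerBrDr -evZ -evD.
  (* The body is instantiated with the whole recursive term at the bound name, so that [chain_Rec]
     applies. *)
  pose g o := if o is Some Y then f Y else Rec (bind f' t).
  have gE u : bind g u = bind (plug (Rec (bind f' t))) (bind f' u).
    rewrite bind_bind; congr bind; apply/funext => -[Y|] //=.
    by rewrite bind_rename bind_Name.
  have gE' u : bind g u = bind f (bind (plug (Rec t)) u).
    by rewrite bind_bind; congr bind; apply/funext => -[Y|].
  have := IH g x; rewrite [in leRHS]gE -(chain_Rec _ tauP); apply: le_trans.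
  apply: ev_le => -[[a u]|[Y|]] /=.
  + by rewrite mulr0 addr0 gE'.
  + by rewrite mulr0 addr0.
  + by rewrite add0r mulr1.
Qed.

Lemma universal_chainE (t : T) x : universal_chain t x = ev t (at_point x).
Proof.
rewrite /universal_chain (least_ofE ev_chain) // => tau tauP {t x} t x.
have := chain_ge tauP t Name x; rewrite bind_Name; apply: le_trans.
apply: ev_le => -[[a u]|Y]; first by rewrite bind_Name.
by rewrite (chain_name tauP) indic_set1 /at_point eq_sym.
Qed.

End UniversalChainTheory.

(** * Finitely supported functions versus weighted lists *)

Section FiniteSupport.
Context {R : realType} {B : choiceType}.

Lemma fsum_seq (r : seq B) (f : B -> R) : uniq r ->
  (forall x, x \notin r -> f x = 0) ->
  \sum_(x \in [set: B]) f x = \sum_(x <- r) f x.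
Proof.
move=> ur f0; rewrite [RHS]fsbig_seq //; apply: esym; apply: fsbig_widen => // x [_ /= xr].
by apply: f0; apply/negP.
Qed.

Lemma fsum_integ {C : choiceType} (l : seq (R * C)) (k : C -> B)
    (h : B -> C -> R) : (forall y p, y != k p -> h y p = 0) ->
  \sum_(y \in [set: B]) integ l (h y) = integ l (fun p => h (k p) p).
Proof.
move=> h0; rewrite (@fsum_seq (undup [seq k p.2 | p <- l])) ?undup_uniq //.
- rewrite /integ exchange_big big_seq [RHS]big_seq; apply: eq_bigr => p pl /=.
  have kp : k p.2 \in undup [seq k q.2 | q <- l].
    by rewrite mem_undup; apply/mapP; exists p.
  rewrite (bigD1_seq (k p.2)) ?undup_uniq //=.
  by rewrite big1 ?addr0 // => y /h0 ->; rewrite mulr0.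
- move=> y; rewrite mem_undup => yl; rewrite /integ big_seq big1 // => p pl.
  rewrite h0 ?mulr0 //; apply: contraNneq yl => ->.
  by apply/mapP; exists p.
Qed.

Lemma fsum_density (l : seq (R * B)) (g : B -> R) :
  \sum_(x \in [set: B]) g x * integ l (at_point x) = integ l g.
Proof.
under eq_fsbigr do rewrite -integZ.
rewrite (fsum_integ _ (k := id)) => [|y p yp]; last first.
  by rewrite /at_point eq_sym (negbTE yp) mulr0.
by congr integ; apply/funext => x; rewrite /at_point eqxx mulr1.
Qed.

Lemma integ_density (l1 l2 : seq (R * B)) :
  (forall x, integ l1 (at_point x) = integ l2 (at_point x)) -> integ l1 = integ l2.
Proof.
move=> l12; apply/funext => f; rewrite -!fsum_density.
by apply: eq_fsbigr => x _; rewrite l12.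
Qed.

Lemma finite_supp_rep (w : B -> R) : finite_set [set x | w x != 0] ->
  (forall x, 0 <= w x) -> exists l, [/\ nneg l,
    forall f, integ l f = \sum_(x \in [set: B]) f x * w x
  & forall x, integ l (at_point x) = w x].
Proof.
move=> /finite_seqP[s sE] w0; pose r := undup s.
have lE f : integ [seq (w x, x) | x <- r] f = \sum_(x \in [set: B]) f x * w x.
  rewrite (@fsum_seq r) ?undup_uniq // => [|x]; last first.
    rewrite mem_undup => xs; suff -> : w x = 0 by rewrite mulr0.
    apply: contraNeq xs => wx.
    by have : [set x | w x != 0] x := wx; rewrite sE.
  by rewrite /integ big_map; apply: eq_bigr => x _; rewrite mulrC.
exists [seq (w x, x) | x <- r]; split=> // [|x].
  by rewrite /nneg all_map; apply/allP => x _ /=.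
rewrite lE (@fsum_seq [:: x]) ?big_seq1 /at_point ?eqxx ?mul1r // => y.
by rewrite inE => /negbTE ->; rewrite mul0r.
Qed.

Lemma finite_supp_density (l : seq (R * B)) :
  finite_set [set x | integ l (at_point x) != 0].
Proof.
apply: (@sub_finite_set _ _ [set` [seq p.2 | p <- l]]); last exact: finite_seq.
move=> x /=; apply: contraNT => xl; rewrite /integ big_seq big1 // => p pl.
rewrite /at_point; case: eqP => [px|]; rewrite ?mulr0 //.
by case/negP: xl; rewrite -px; apply: map_f.
Qed.

End FiniteSupport.

(** * Optimal transport between finitely supported probabilities *)

Section Transport.
Context {R : realType} {B : choiceType}.
Implicit Types (mu nu rho : (B -> R) -> R) (d : B -> B -> R).

(* A finitely supported probability, as an integration functional. *)
Definition prob mu : Prop :=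
  (exists l, nneg l /\ mu = integ l) /\ mu (fun=> 1) = 1.

Definition lcoupling mu nu (l : seq (R * (B * B))) : Prop :=
  [/\ nneg l, forall f, integ l (f \o fst) = mu f
    & forall f, integ l (f \o snd) = nu f].

Definition cost d (p : B * B) : R := d p.1 p.2.

Definition ot d mu nu : R :=
  inf [set integ l (cost d) | l in lcoupling mu nu].

(** Both infima range over the same set of costs: a coupling function is listed on its finite
    support, and a list yields the function of its point masses. *)
Lemma kantorovichE d mu nu : prob mu -> prob nu ->
  kantorovich d (mu \o at_point) (nu \o at_point) = ot d mu nu.
Proof.
move=> [[l1 [l10 muE]] mu1] [[l2 [l20 nuE]] nu1]; congr inf; apply/seteqP; split.
- move=> _ [w [[fin w0 w1] wm wn] <-].
  have [l [l0 lE lw]] := finite_supp_rep fin w0.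
  exists l; last by rewrite lE.
  split=> // f.
  + have -> : mu = integ (wmap 1 fst l).
      rewrite muE; apply: integ_density => x; rewrite -muE integ_wmap mul1r.
      rewrite -[LHS]/((mu \o at_point) x) -wm; under eq_fsbigr do rewrite -lw.
      rewrite (fsum_integ _ (k := snd)) => [|y p]; last first.
        by rewrite /at_point -pair_eqE /= eq_sym => /negbTE ->; rewrite andbF.
      congr integ; apply/funext => p.
      by rewrite /at_point -pair_eqE /= eqxx andbT.
    by rewrite integ_wmap mul1r.
  + have -> : nu = integ (wmap 1 snd l).
      rewrite nuE; apply: integ_density => x; rewrite -nuE integ_wmap mul1r.
      rewrite -[LHS]/((nu \o at_point) x) -wn; under eq_fsbigr do rewrite -lw.
      rewrite (fsum_integ _ (k := fst)) => [|y p]; last first.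
        by rewrite /at_point -pair_eqE /= eq_sym => /negbTE ->.
      congr integ; apply/funext => p.
      by rewrite /at_point -pair_eqE /= eqxx.
    by rewrite integ_wmap mul1r.
- move=> _ [l [l0 lmu lnu] <-]; exists (fun p => integ l (at_point p)); last first.
    exact: (fsum_density l (cost d)).
  split; first split.
  + exact: finite_supp_density.
  + by move=> p; apply: integ_ge0 => // q; have /andP[] := at_point_bounds (R := R) p q.
  + rewrite /mass -mu1 -lmu -fsum_density.
    by apply: eq_fsbigr => p _; rewrite mul1r.
  + move=> x; rewrite (fsum_integ _ (k := snd)) => [|y p]; last first.
      by rewrite /at_point -pair_eqE /= eq_sym => /negbTE ->; rewrite andbF.
    rewrite -[RHS]lmu; congr integ; apply/funext => p.
    by rewrite /at_point -pair_eqE /= eqxx andbT.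
  + move=> x; rewrite (fsum_integ _ (k := fst)) => [|y p]; last first.
      by rewrite /at_point -pair_eqE /= eq_sym => /negbTE ->.
    rewrite -[RHS]lnu; congr integ; apply/funext => p.
    by rewrite /at_point -pair_eqE /= eqxx.
Qed.

Lemma ot_le d mu nu l : (forall x y, 0 <= d x y) -> lcoupling mu nu l ->
  ot d mu nu <= integ l (cost d).
Proof.
move=> d0 lP; apply: ge_inf; last by exists l.
by exists 0 => _ [k [k0 _ _] <-]; apply: integ_ge0 => // -[].
Qed.

Lemma lcoupling_product mu nu : prob mu -> prob nu -> exists l, lcoupling mu nu l.
Proof.
move=> [[l1 [l10 ->]] mu1] [[l2 [l20 ->]] nu1].
have lE f : integ [seq (p.1 * q.1, (p.2, q.2)) | p <- l1, q <- l2] f =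
    integ l1 (fun x => integ l2 (fun y => f (x, y))).
  rewrite /integ big_allpairs_dep; apply: eq_bigr => p _ /=.
  by rewrite mulr_sumr; apply: eq_bigr => q _; rewrite mulrA.
exists [seq (p.1 * q.1, (p.2, q.2)) | p <- l1, q <- l2]; split=> [|f|f].
- apply/allP => _ /allpairsP[[p q] [/= pl ql ->]] /=.
  by apply: mulr_ge0; [move/allP: l10; exact|move/allP: l20; exact].
- rewrite lE; congr integ; apply/funext => x /=.
  by have := integZ l2 (f x) (fun=> 1); rewrite mulr1 nu1 mulr1.
- rewrite lE /=; have := integZ l1 (integ l2 f) (fun=> 1).
  by rewrite mulr1 mu1 mulr1.
Qed.

(** Couplings optimal up to [eta] replace optimal ones, so the estimates below avoid attainment of
    the infimum. *)
Lemma ot_adherent d mu nu eta : (forall x y, 0 <= d x y) ->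
  prob mu -> prob nu -> 0 < eta :> R ->
  exists l, lcoupling mu nu l /\ integ l (cost d) < ot d mu nu + eta.
Proof.
move=> d0 muP nuP eta0; have [l lP] := lcoupling_product muP nuP.
have inf_l : has_inf [set integ l (cost d) | l in lcoupling mu nu].
  split; first by exists (integ l (cost d)), l.
  by exists 0 => _ [k [k0 _ _] <-]; apply: integ_ge0 => // -[].
by have [_ [k kP <-] kE] := inf_adherent eta0 inf_l; exists k.
Qed.

Lemma ot_ge0 d mu nu : (forall x y, 0 <= d x y) -> prob mu -> prob nu ->
  0 <= ot d mu nu.
Proof.
move=> d0 muP nuP; have [l lP] := lcoupling_product muP nuP.
apply: lb_le_inf; first by exists (integ l (cost d)), l.
by move=> _ [k [k0 _ _] <-]; apply: integ_ge0 => // -[].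
Qed.

Lemma ot_mono d d' mu nu : (forall x y, 0 <= d x y) -> le_pointwise d d' ->
  prob mu -> prob nu -> ot d mu nu <= ot d' mu nu.
Proof.
move=> d0 dd' muP nuP; apply/ler_addgt0Pr => eta eta0.
have d'0 x y : 0 <= d' x y by apply: le_trans (dd' x y).
have [l [lP /ltW lE]] := ot_adherent d'0 muP nuP eta0.
apply: le_trans lE; apply: le_trans (ot_le d0 lP) _.
by case: lP => l0 _ _; apply: integ_le => // -[x y]; apply: dd'.
Qed.

Lemma ot_diag d mu : (forall x y, 0 <= d x y) -> (forall x, d x x = 0) ->
  prob mu -> ot d mu mu = 0.
Proof.
move=> d0 dxx muP; apply/eqP; rewrite eq_le ot_ge0 // andbT.
case: (muP) => -[l [l0 muE]] mu1.
have lP : lcoupling mu mu (wmap 1 (fun x => (x, x)) l).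
  split=> [|f|f]; first by apply: nneg_wmap.
  by rewrite integ_wmap mul1r muE.
  by rewrite integ_wmap mul1r muE.
apply: le_trans (ot_le d0 lP) _; rewrite integ_wmap mul1r.
have -> : cost d \o (fun x => (x, x)) = (fun=> 0 * 0).
  by apply/funext => x; rewrite /cost /= dxx mul0r.
by rewrite integZ mul0r.
Qed.

Lemma ot_swap d mu nu : (forall x y, 0 <= d x y) -> (forall x y, d x y = d y x) ->
  prob mu -> prob nu -> ot d mu nu <= ot d nu mu.
Proof.
move=> d0 dC muP nuP; apply/ler_addgt0Pr => eta eta0.
have [l [[l0 lnu lmu] /ltW lE]] := ot_adherent d0 nuP muP eta0.
have lP : lcoupling mu nu (wmap 1 (fun p => (p.2, p.1)) l).
  split=> [|f|f]; first by apply: nneg_wmap.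
  by rewrite integ_wmap mul1r -lmu.
  by rewrite integ_wmap mul1r -lnu.
apply: le_trans (ot_le d0 lP) _; apply: le_trans lE.
rewrite integ_wmap mul1r; apply: integ_le => // -[x y].
by rewrite /cost /= dC.
Qed.

(* Gluing: the conditional laws of [l1] and [l2] given the middle point y are
   taken independent; the weights divide by the mass c y of y, and points with
   c y = 0 have weight 0 in [l1] and [l2]. *)
Lemma lcoupling_glue mu nu rho l1 l2 : prob nu ->
  lcoupling mu nu l1 -> lcoupling nu rho l2 ->
  exists l : seq (R * (B * B * B)), [/\ nneg l,
    forall f, integ l (fun p => f p.1) = integ l1 f
  & forall f, integ l (fun p => f (p.1.2, p.2)) = integ l2 f].
Proof.
move=> [[l3 [l30 nuE]] nu1] [l10 _ l1nu] [l20 l2nu _].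
pose c y := nu (at_point y).
have c0 y : 0 <= c y.
  by rewrite /c nuE; apply: integ_ge0 => // x; have /andP[] := at_point_bounds (R := R) y x.
have nu_c : nu (fun y => (c y == 0)%:R) = 0.
  rewrite nuE -fsum_density fsbig1 // => y _; rewrite -nuE -/(c y).
  by case: eqP => [->|]; rewrite ?mulr0 ?mul0r.
have cancel (k : seq (R * (B * B))) (y : B * B -> B) g : nneg k ->
    integ k (fun p => (c (y p) == 0)%:R) = 0 ->
    integ k (fun p => g p * (c (y p) / c (y p))) = integ k g.
  move=> k0 kc; apply/eqP; rewrite -subr_eq0 -integB; apply/eqP.
  apply: (integ_eq0 (f := fun p => (c (y p) == 0)%:R)) => // [p|]; last by rewrite kc.
  have [_ /eqP|cy _] := eqVneq (c (y p)) 0; first by rewrite oner_eq0.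
  by rewrite divff // mulr1 subrr.
pose W (p q : R * (B * B)) : R * (B * B * B) :=
  (p.1 * q.1 * (p.2.2 == q.2.1)%:R / c p.2.2, (p.2, q.2.2)).
exists [seq W p q | p <- l1, q <- l2]; split=> [|f|f].
- apply/allP => _ /allpairsP[[p q] [/= pl ql ->]] /=.
  rewrite !mulr_ge0 ?invr_ge0 ?c0 //; first by move/allP: l10; exact.
  by move/allP: l20; exact.
- rewrite -(cancel l1 snd f) //; last by rewrite -[RHS]nu_c -l1nu.
  rewrite {1}/integ big_allpairs_dep; apply: eq_bigr => p _ /=.
  have -> : c p.2.2 = \sum_(q <- l2) q.1 * (p.2.2 == q.2.1)%:R.
    rewrite /c -l2nu; apply: eq_bigr => q _; by rewrite /at_point /= eq_sym.
  rewrite [in RHS]mulrA mulrA [RHS]mulrAC mulr_sumr.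
  by apply: eq_bigr => q _; ring.
- rewrite -(cancel l2 fst f) //; last by rewrite -[RHS]nu_c -l2nu.
  rewrite {1}/integ big_allpairs_dep exchange_big; apply: eq_bigr => q _ /=.
  have -> : c q.2.1 / c q.2.1 =
      \sum_(p <- l1) p.1 * (p.2.2 == q.2.1)%:R / c q.2.1.
    by rewrite -mulr_suml; congr (_ / _); rewrite /c -l1nu.
  rewrite !mulr_sumr; apply: eq_bigr => -[w [x y]] _ /=.
  case: eqP => [->|_]; last by rewrite !(mulr0, mul0r).
  by case: q.2 => y' z /=; ring.
Qed.

Lemma ot_triangle d mu nu rho : (forall x y, 0 <= d x y) ->
  (forall x y z, d x z <= d x y + d y z) -> prob mu -> prob nu -> prob rho ->
  ot d mu rho <= ot d mu nu + ot d nu rho.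
Proof.
move=> d0 dtri muP nuP rhoP; apply/ler_addgt0Pr => eta eta0.
have eta20 : 0 < eta / 2 by rewrite divr_gt0.
have [l1 [l1P l1E]] := ot_adherent d0 muP nuP eta20.
have [l2 [l2P l2E]] := ot_adherent d0 nuP rhoP eta20.
have [l [l0 ll1 ll2]] := lcoupling_glue nuP l1P l2P.
have lP : lcoupling mu rho (wmap 1 (fun p => (p.1.1, p.2)) l).
  split=> [|f|f]; first by apply: nneg_wmap.
    by case: l1P => _ <- _; rewrite integ_wmap mul1r -ll1.
  by case: l2P => _ _ <-; rewrite integ_wmap mul1r -ll2.
apply: le_trans (ot_le d0 lP) _; rewrite integ_wmap mul1r.
apply: (@le_trans _ _ (integ l1 (cost d) + integ l2 (cost d))); last by lra.
rewrite -ll1 -ll2 -integD; apply: integ_le => // -[[x y] z].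
exact: dtri.
Qed.

Definition mixf (e : R) mu nu (f : B -> R) : R := e * mu f + (1 - e) * nu f.

(** A mixture of couplings couples the mixtures. *)
Lemma ot_mix d e mu mu' nu nu' : (forall x y, 0 <= d x y) -> 0 <= e <= 1 ->
  prob mu -> prob mu' -> prob nu -> prob nu' ->
  ot d (mixf e mu mu') (mixf e nu nu') <= e * ot d mu nu + (1 - e) * ot d mu' nu'.
Proof.
move=> d0 /andP[e0 e1] muP mu'P nuP nu'P; apply/ler_addgt0Pr => eta eta0.
have [l [[l0 l1 l2] lE]] := ot_adherent d0 muP nuP eta0.
have [k [[k0 k1 k2] kE]] := ot_adherent d0 mu'P nu'P eta0.
have lkP : lcoupling (mixf e mu mu') (mixf e nu nu')
    (wmap e id l ++ wmap (1 - e) id k).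
  split=> [|f|f]; first by apply: nneg_cat; apply: nneg_wmap; rewrite ?subr_ge0.
    by rewrite integ_cat !integ_wmap l1 k1.
  by rewrite integ_cat !integ_wmap l2 k2.
apply: le_trans (ot_le d0 lkP) _; rewrite integ_cat !integ_wmap.
have {}lE := ltW lE; have {}kE := ltW kE.
have := ler_wpM2l e0 lE; have e1' : 0 <= 1 - e by rewrite subr_ge0.
have := ler_wpM2l e1' kE; rewrite /=; lra.
Qed.

(* On the finite supports |f x - f y| <= C d x y for some constant C. *)
Lemma ot_eq0 d mu nu (f : B -> R) : (forall x y, 0 <= d x y) ->
  prob mu -> prob nu -> ot d mu nu = 0 ->
  (forall x y, d x y = 0 -> f x = f y) -> mu f = nu f.
Proof.
move=> d0 muP nuP d_mn df.
case: (muP) => -[l1 [l10 muE]] _; case: (nuP) => -[l2 [l20 nuE]] _.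
pose s (l : seq (R * B)) := [seq p.2 | p <- l].
(* [C] dominates every quotient [|f x - f y| / d x y] over the two lists; quotients by 0 count as 0,
   and there [f x = f y]. *)
pose C := \sum_(x <- s l1) \sum_(y <- s l2) `|f x - f y| / d x y.
have C0 : 0 <= C.
  by apply: sumr_ge0 => x _; apply: sumr_ge0 => y _; rewrite mulr_ge0 ?invr_ge0.
have Cf x y : x \in s l1 -> y \in s l2 -> `|f x - f y| <= C * d x y.
  move=> xs ys; have [dxy|dxy] := eqVneq (d x y) 0.
    by rewrite (df _ _ dxy) subrr normr0 mulr_ge0.
  rewrite -ler_pdivrMr; last by rewrite lt_def dxy d0.
  rewrite /C (big_rem x) //= (big_rem y) //= -addrA lerDl addr_ge0 //.
    by apply: sumr_ge0 => z _; rewrite mulr_ge0 ?invr_ge0.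
  by apply: sumr_ge0 => z _; apply: sumr_ge0 => z' _; rewrite mulr_ge0 ?invr_ge0.
(* An entry of positive weight lies over the listed points: otherwise the indicator of its image
   would have positive integral against [k] and integral 0 against [l]. *)
have supp (k : seq (R * (B * B))) (g : B * B -> B) (l : seq (R * B)) p : nneg k ->
    (forall h, integ k (h \o g) = integ l h) -> p \in k -> 0 < p.1 ->
    g p.2 \in s l.
  move=> k0 kl pk p0; apply: contraT => gs.
  have : 0 < integ k (at_point (g p.2) \o g).
    rewrite /integ (big_rem p) //= /at_point eqxx mulr1 ltr_pwDl //.
    rewrite big_seq; apply: sumr_ge0 => q /mem_rem qk.
    by rewrite mulr_ge0 //; move/allP: k0; exact.
  rewrite kl /integ big_seq big1 ?ltxx // => q ql; rewrite /at_point.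
  case: eqP => [qp|]; rewrite ?mulr0 //.
  by case/negP: gs; rewrite -qp; apply: map_f.
apply/eqP; rewrite -subr_eq0 -normr_eq0 eq_le normr_ge0 andbT.
apply/ler_addgt0Pr => eta eta0; rewrite add0r.
(* Dividing by [C + 1] rather than [C] covers [C = 0]. *)
have eta'0 : 0 < eta / (C + 1) by rewrite divr_gt0 // ltr_wpDl.
have [l [[l0 lmu lnu] lE]] := ot_adherent d0 muP nuP eta'0.
rewrite -lmu -lnu -integB; apply: (@le_trans _ _ (C * integ l (cost d))).
  rewrite /integ mulr_sumr; apply: le_trans (ler_norm_sum _ _ _) _.
  rewrite big_seq [leRHS]big_seq; apply: ler_sum => p pl.
  have p0 : 0 <= p.1 by move/allP: l0; exact.
  rewrite normrM ger0_norm // mulrCA.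
  move: p0; rewrite le_eqVlt => /orP[/eqP <-|p0]; first by rewrite !mul0r.
  rewrite ler_wpM2l ?(ltW p0) //; apply: Cf.
    by apply: (supp l fst l1) => // h; rewrite lmu muE.
  by apply: (supp l snd l2) => // h; rewrite lnu nuE.
rewrite d_mn add0r in lE.
apply: le_trans (ler_wpM2l C0 (ltW lE)) _.
rewrite mulrCA ger_pMr // ler_pdivrMr ?ltr_wpDl // mul1r lerDl ler01 //.
Qed.

Lemma ot_le1 d mu nu : (forall x y, 0 <= d x y <= 1) -> prob mu -> prob nu ->
  ot d mu nu <= 1.
Proof.
move=> d01 muP nuP; have d0 x y : 0 <= d x y by have /andP[] := d01 x y.
have [l lP] := lcoupling_product muP nuP; apply: le_trans (ot_le d0 lP) _.
case: lP => l0 lmu _; case: (muP) => _ <-; rewrite -lmu; apply: integ_le => // p.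
by have /andP[] := d01 p.1 p.2.
Qed.

Lemma ot_pseudometric1 {I : Type} d (F : I -> (B -> R) -> R) :
  pseudometric1 d -> (forall i, prob (F i)) ->
  pseudometric1 (fun i j => ot d (F i) (F j)).
Proof.
move=> [dxx dC dtri d01] FP.
have d0 x y : 0 <= d x y by have /andP[] := d01 x y.
split=> [i|i j|i j k|i j]; first exact: ot_diag.
- by apply/eqP; rewrite eq_le !ot_swap.
- exact: ot_triangle.
- by rewrite ot_ge0 // ot_le1.
Qed.

(* Moving every point to a representative of its class costs nothing. *)
Lemma ot_eq0_invariant d mu nu : pseudometric1 d -> prob mu -> prob nu ->
  (forall f : B -> R, (forall x y, d x y = 0 -> f x = f y) -> mu f = nu f) ->
  ot d mu nu = 0.
Proof.
move=> dP muP nuP mn; have [dxx dC dtri d01] := dP.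
have d0 x y : 0 <= d x y by have /andP[] := d01 x y.
(* [choose] returns the same point for extensionally equal predicates, whichever satisfying element
   is its default; hence one representative per class. *)
pose r x := choose (fun y => d x y == 0) x.
have dr x : d x (r x) = 0 by apply/eqP/(@chooseP _ (fun y => d x y == 0))/eqP.
have rE x y : d x y = 0 -> r x = r y.
  move=> dxy; have xy z : (d x z == 0) = (d y z == 0).
    apply/eqP/eqP => dz; apply/eqP; rewrite eq_le d0 andbT.
      by apply: le_trans (dtri y x z) _; rewrite dC dxy dz addr0.
    by apply: le_trans (dtri x y z) _; rewrite dxy dz addr0.
  rewrite /r (eq_choose xy); apply: choose_id; last by rewrite dxx.
  by rewrite dC dxy.
pose push (m : (B -> R) -> R) f := m (f \o r).
have pushP m : prob m -> prob (push m) /\ ot d m (push m) = 0.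
  move=> mP; have [[l [l0 mE]] m1] := mP.
  have pP : prob (push m).
    split=> //; exists (wmap 1 r l); split; first exact: nneg_wmap.
    by apply/funext => f; rewrite integ_wmap mul1r /push mE.
  split=> //; apply/eqP; rewrite eq_le ot_ge0 // andbT.
  have lP : lcoupling m (push m) (wmap 1 (fun x => (x, r x)) l).
    split=> [|f|f]; first by apply: nneg_wmap.
      by rewrite integ_wmap mul1r mE.
    by rewrite integ_wmap mul1r /push mE.
  apply: le_trans (ot_le d0 lP) _; rewrite integ_wmap mul1r.
  have -> : cost d \o (fun x => (x, r x)) = (fun=> 0 * 0).
    by apply/funext => x; rewrite /cost /= dr mul0r.
  by rewrite integZ mul0r.
have [pmuP mu0] := pushP _ muP; have [pnuP nu0] := pushP _ nuP.
have pE : push mu = push nu.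
  by apply/funext => f; apply: mn => x y /rE /= ->.
apply/eqP; rewrite eq_le ot_ge0 // andbT.
apply: le_trans (ot_triangle d0 dtri muP pmuP nuP) _; rewrite mu0 add0r pE.
by rewrite -nu0 ot_swap.
Qed.

End Transport.

(** * Least fixed points among 1-bounded pseudometrics *)

Section LeastFixpoint.
Context {R : realType} {A : Type}.
Implicit Types d g : A -> A -> R.

(* Suprema of pseudometrics are pseudometrics but infima are not: the least
   fixed point is the supremum of the pseudometrics below all prefixed ones. *)
Lemma least_pseudometric1_fixpoint (Phi : (A -> A -> R) -> A -> A -> R) :
  (forall d, pseudometric1 d -> pseudometric1 (Phi d)) ->
  (forall d g, pseudometric1 d -> pseudometric1 g -> le_pointwise d g ->
     le_pointwise (Phi d) (Phi g)) ->
  let D := least_of [set d | pseudometric1 d /\ Phi d = d] in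
  [/\ pseudometric1 D, Phi D = D & forall g, pseudometric1 g ->
      le_pointwise (Phi g) g -> le_pointwise D g].
Proof.
move=> Phi_pm Phi_mono.
pose pre g := pseudometric1 g /\ le_pointwise (Phi g) g.
pose low d := pseudometric1 d /\ forall g, pre g -> le_pointwise d g.
pose F x y := [set d x y | d in low].
pose D x y := sup (F x y).
have zero_low : low (fun _ _ => 0).
  split=> [|g [[_ _ _ g01] _] x y]; last by have /andP[] := g01 x y.
  by split=> // *; rewrite ?addr0 // lexx ler01.
have F0 x y : F x y !=set0 by exists 0, (fun _ _ => 0).
have F1 x y : has_ubound (F x y).
  by exists 1 => _ [d [[_ _ _ d01] _] <-]; have /andP[] := d01 x y.
have le_D d : low d -> le_pointwise d D.
  by move=> dl x y; apply: (ub_le_sup (F1 x y)); exists d.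
have D_le x y c : (forall d, low d -> d x y <= c) -> D x y <= c.
  by move=> h; apply: ge_sup => // _ [d dl <-]; apply: h.
have D_pm : pseudometric1 D.
  split=> [x|x y|x y z|x y].
  - apply/eqP; rewrite eq_le (le_D _ zero_low x x) andbT.
    by apply: D_le => d [[-> _ _ _] _].
  - by apply/eqP; rewrite eq_le !D_le // => d dl; case: (dl) => -[_ -> _ _] _; apply: le_D.
  - apply: D_le => d dl; case: (dl) => -[_ _ tri _] _.
    by apply: le_trans (tri x y z) _; apply: lerD; apply: le_D.
  - rewrite (le_D _ zero_low) D_le // => d [[_ _ _ d01] _].
    by have /andP[] := d01 x y.
have D_min g : pre g -> le_pointwise D g.
  by move=> gP x y; apply: D_le => d [_ dg]; apply: dg.
(* [Phi D] lies below every prefixed [g], since [Phi D <= Phi g <= g]; so it is one of the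
   pseudometrics whose supremum is [D]. *)
have D_pre : le_pointwise (Phi D) D.
  apply: le_D; split=> [|g gP x y]; first exact: Phi_pm.
  have [g_pm Phi_g] := gP.
  by apply: le_trans (Phi_g x y); apply: Phi_mono => //; apply: D_min.
have D_fix : Phi D = D.
  apply: le_pointwise_anti => //; apply: D_min; split; first exact: Phi_pm.
  by apply: Phi_mono => //; apply: Phi_pm.
rewrite /= (@least_ofE _ _ _ _ D) //; first by split=> // g g_pm gP; apply: D_min.
move=> g [g_pm gE]; apply: D_min; split=> //; rewrite gE => x y; exact: lexx.
Qed.

End LeastFixpoint.

(** * The discounted distance, its kernel and coinduction *)

Section Distance.
Context {R : realType} {L X : countType} (X_infinite : infinite_set [set: X]).
Context {lam : R} (lam01 : 0 < lam <= 1).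
Local Notation T := (term R L void X).
Local Notation A := (L * T + X)%type.
Implicit Types (d g : T -> T -> R) (t s u v : T) (phi : A -> R).

(** Integral against the completed distribution: subtracting [f None] leaves an integrand that
    vanishes at bottom, where the missing mass sits. *)
Definition ev_star t (f : option A -> R) : R :=
  f None + ev t (fun x => f (Some x) - f None).

Lemma prob_ev_star t : prob (ev_star t).
Proof.
split; last by rewrite /ev_star subrr ev0 addr0.
have [l [l0 l1 lE]] := ev_rep t; rewrite /ev_star lE.
exists ((1 - integ l (fun=> 1), None) :: wmap 1 Some l); split.
  by rewrite /nneg /= subr_ge0 l1; apply: nneg_wmap.
apply/funext => f; rewrite integ_cons integ_wmap mul1r /= integB.
have := integZ l (f None) (fun=> 1); rewrite mulr1 => ->.
rewrite (_ : f \o Some = fun x => f (Some x)) //; ring.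
Qed.

Lemma star_universal_chain t :
  star (universal_chain t) = ev_star t \o at_point.
Proof.
apply/funext => -[x|] /=; rewrite /ev_star.
  rewrite universal_chainE // {1}/at_point add0r; congr ev.
  by apply/funext => y; rewrite /at_point subr0.
rewrite {1}/at_point eqxx /= /mass; congr (1 + _).
have [l [l0 l1 lE]] := ev_rep t.
transitivity (- ev t (fun=> 1)).
  rewrite lE -(fsum_density l (fun=> 1)); congr (- _).
  by apply: eq_fsbigr => x _; rewrite universal_chainE // lE mul1r.
rewrite -mulN1r -evZ; congr ev.
by apply/funext => x; rewrite /at_point /= sub0r mulr1.
Qed.

(** Closed form of [Lambda lam d]: distinct points left free by the constraint get the maximal value
    1. *)
Definition label_dist d (x y : option A) : R :=
  match x, y with
  | None, None => 0
  | Some (inl (a, t)), Some (inl (b, s)) => if a == b then lam * d t s else 1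
  | Some (inr Y), Some (inr Z) => (Y != Z)%:R
  | _, _ => 1
  end.

Lemma label_dist_pseudometric1 d : pseudometric1 d -> pseudometric1 (label_dist d).
Proof.
move=> [dxx dC dtri d01]; have /andP[lam0 lam1] := lam01.
have ld0 t s : 0 <= lam * d t s.
  by apply: mulr_ge0; [apply: ltW|have /andP[] := d01 t s].
have ld1 t s : lam * d t s <= 1.
  by have /andP[d0 d1] := d01 t s; rewrite mulr_ile1 // ltW.
have bounds x y : 0 <= label_dist d x y <= 1.
  case: x y => [[[a t]|Y]|] [[[b s]|Z]|] /=; rewrite ?lexx ?ler01 //.
    by case: ifP => _; rewrite ?ld0 ?ld1 ?lexx ?ler01.
  by case: eqP => _; rewrite ?lexx ?ler01.
have ge0 x y : 0 <= label_dist d x y by have /andP[] := bounds x y.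
have le1 x y : label_dist d x y <= 1 by have /andP[] := bounds x y.
split=> // [[[[a t]|Y]|]|x y|x y z] //=.
- by rewrite eqxx dxx mulr0.
- by rewrite eqxx.
- case: x y => [[[a t]|Y]|] [[[b s]|Z]|] //=; last by rewrite eq_sym.
  by rewrite eq_sym; case: eqP => // _; rewrite dC.
- have far1 : label_dist d x y = 1 -> label_dist d x z <= label_dist d x y + label_dist d y z.
    by move=> ->; apply: le_trans (le1 x z) _; rewrite lerDl.
  have far2 : label_dist d y z = 1 -> label_dist d x z <= label_dist d x y + label_dist d y z.
    by move=> ->; apply: le_trans (le1 x z) _; rewrite lerDr.
  case: x y z far1 far2 => [[[a t]|Y]|] [[[b s]|Z]|] [[[c u]|W]|] /= far1 far2;
    do ?[exact: far1|exact: far2|by rewrite addr0].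
  + move: far1 far2; case: (eqVneq a b) => [<-|_] far1 far2; last exact: far1.
    case: (eqVneq a c) far2 => [_ _|_]; last exact.
    by rewrite -mulrDr ler_wpM2l // ltW.
  + move: far1 far2; case: (eqVneq Y Z) => [<-|_] far1 far2; last exact: far1.
    by rewrite add0r.
Qed.

Lemma LambdaE d : pseudometric1 d -> Lambda lam d = label_dist d.
Proof.
move=> d_pm; apply: greatest_ofE; first split.
- exact: label_dist_pseudometric1.
- by move=> a t s; rewrite /= eqxx.
- move=> m [[mxx _ _ m01] mE] x y.
  have m1 : m x y <= 1 by have /andP[] := m01 x y.
  case: x y m1 => [[[a t]|Y]|] [[[b s]|Z]|] //= m1; last by rewrite mxx.
  + by case: (eqVneq a b) => [<-|//]; rewrite mE.
  + by case: (eqVneq Y Z) => [<-|//]; rewrite mxx.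
Qed.

Lemma PsiE d : pseudometric1 d ->
  Psi lam d = fun t s => ot (label_dist d) (ev_star t) (ev_star s).
Proof.
move=> d_pm; apply/funext => t; apply/funext => s.
by rewrite /Psi LambdaE // !star_universal_chain kantorovichE //; apply: prob_ev_star.
Qed.

Local Notation D := (@discounted_distance R L X lam).

Lemma discounted_distance_lfp :
  [/\ pseudometric1 D, Psi lam D = D & forall g, pseudometric1 g ->
      le_pointwise (Psi lam g) g -> le_pointwise D g].
Proof.
apply: least_pseudometric1_fixpoint => [d d_pm|d g d_pm g_pm dg].
  rewrite PsiE //; apply: ot_pseudometric1; last exact: prob_ev_star.
  exact: label_dist_pseudometric1.
rewrite !PsiE // => t s; apply: ot_mono; try exact: prob_ev_star.
  move=> x y; have [_ _ _ /(_ x y)/andP[]//] := label_dist_pseudometric1 d_pm.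
have /andP[/ltW lam0 _] := lam01.
move=> [[[a u]|Y]|] [[[b v]|Z]|] //=; case: eqP => // _.
by rewrite ler_wpM2l.
Qed.

Lemma discounted_distance_pm : pseudometric1 D.
Proof. by have [] := discounted_distance_lfp. Qed.

Lemma discounted_distanceE t s : D t s = ot (label_dist D) (ev_star t) (ev_star s).
Proof.
have [_ DE _] := discounted_distance_lfp.
by rewrite -[in LHS]DE PsiE //; exact: discounted_distance_pm.
Qed.

Definition respects (E : T -> T -> Prop) phi : Prop :=
  forall a u v, E u v -> phi (inl (a, u)) = phi (inl (a, v)).

Definition bisimilar t s : Prop := D t s = 0.

(** As [lam > 0], label distance 0 forces equal points, or equal labels with bisimilar targets; so
    [phi], extended by 0 at bottom, meets the condition of [ot_eq0]. *)
Lemma bisim_ev t s phi : bisimilar t s -> respects bisimilar phi -> ev t phi = ev s phi.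
Proof.
move=> ts phiP; pose f o := if o is Some x then phi x else 0 : R.
have evE u : ev_star u f = ev u phi.
  rewrite /ev_star /= add0r; congr ev.
  by apply/funext => x; rewrite subr0.
have lD := label_dist_pseudometric1 discounted_distance_pm; have /andP[lam0 _] := lam01.
rewrite -!evE; apply: (ot_eq0 (d := label_dist D)); try exact: prob_ev_star.
- by move=> x y; have [_ _ _ /(_ x y)/andP[]] := lD.
- by rewrite -discounted_distanceE.
- move=> [[[a u]|Y]|] [[[b v]|Z]|] //= /eqP; rewrite ?oner_eq0 //.
    case: (eqVneq a b) => [<-|_]; last by rewrite oner_eq0.
    by rewrite mulf_eq0 gt_eqF //= => /eqP; apply: phiP.
  by case: (eqVneq Y Z) => [->//|_]; rewrite oner_eq0.
Qed.

Lemma coinduction (E : T -> T -> Prop) :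
  (forall t s, E t s -> forall phi, respects E phi -> respects bisimilar phi ->
     ev t phi = ev s phi) ->
  forall t s, E t s -> bisimilar t s.
Proof.
move=> E_ev t0 s0 Ets.
pose S u v := E u v \/ bisimilar u v.
(* The equivalence generated by [S], encoded as agreement on all [S]-invariant predicates. *)
pose Eq t s := forall P : T -> Prop, (forall u v, S u v -> P u = P v) -> P t = P s.
have Eq_S t s : S t s -> Eq t s by move=> ts P; apply.
have Eq_ev t s phi : Eq t s -> respects Eq phi -> ev t phi = ev s phi.
  move=> ts phiP; have S_ev u v : S u v -> ev u phi = ev v phi.
    have iE : respects E phi by move=> a p q pq; apply/phiP/Eq_S; left.
    have iB : respects bisimilar phi by move=> a p q pq; apply/phiP/Eq_S; right.
    by case=> [uv|uv]; [apply: E_ev|apply: bisim_ev].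
  (* Integrating [phi] as [t] does is an [S]-invariant predicate, so it transfers from [t] to
     [s]. *)
  have <- // := ts (fun u => ev t phi = ev u phi).
  by move=> u v /S_ev ->.
pose g t s : R := (~~ `[< Eq t s >])%:R.
have gE t s : Eq t s -> g t s = 0 by move=> ts; rewrite /g asboolT.
have gN t s : ~ Eq t s -> g t s = 1 by move=> ts; rewrite /g asboolF.
have g01 t s : 0 <= g t s <= 1.
  by rewrite /g; case: asboolP => _; rewrite ?lexx ?ler01.
have g_pm : pseudometric1 g.
  split=> // [t|t s|t s u].
  - by apply: gE => P.
  - rewrite /g; congr ((~~ _)%:R : R); apply/asboolP/asboolP => h P /h//.
  - have [ts|ts] := pselect (Eq t s); last first.
      rewrite (gN _ _ ts); have /andP[_ h] := g01 t u; have /andP[h' _] := g01 s u.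
      by apply: le_trans h _; rewrite lerDl.
    have [su|su] := pselect (Eq s u); last first.
      rewrite (gN _ _ su); have /andP[_ h] := g01 t u; have /andP[h' _] := g01 t s.
      by apply: le_trans h _; rewrite lerDr.
    by rewrite !gE ?addr0 // => P h; rewrite (ts P h) (su P h).
have [_ _ D_min] := discounted_distance_lfp.
have /andP[lam0 _] := lam01.
apply/eqP; rewrite eq_le; have [_ _ _ /(_ t0 s0)/andP[-> _]] := discounted_distance_pm; rewrite andbT.
rewrite -(gE t0 s0); last by apply: Eq_S; left.
apply: D_min => // t s; rewrite PsiE //.
have lg := label_dist_pseudometric1 g_pm.
have [ts|ts] := pselect (Eq t s); last first.
  rewrite gN //; apply: ot_le1; try exact: prob_ev_star.
  by case: lg.
rewrite gE // ot_eq0_invariant //; try exact: prob_ev_star.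
move=> f fP; rewrite /ev_star; congr (_ + _); apply: Eq_ev => // a u v uv.
by congr (_ - _); apply: fP; rewrite /= eqxx gE // mulr0.
Qed.

End Distance.

(** * Distance 0 under recursion, and estimates for prefix and sum *)

Section Bisimilarity.
Context {R : realType} {L X : countType} (X_infinite : infinite_set [set: X]).
Context {lam : R} (lam01 : 0 < lam <= 1).
Local Notation T := (term R L void X).
Local Notation A := (L * T + X)%type.
Local Notation D := (@discounted_distance R L X lam).
Local Notation bisim := (@bisimilar R L X lam).
Implicit Types (t s u v m : T) (phi : A -> R).

Lemma ev_subst t Y s phi :
  ev (subst t Y s) phi = ev t (fun x => match x with
    | inl (a, u) => phi (inl (a, subst u Y s))
    | inr Z => if Z == Y then ev s phi else phi (inr Z) end).
Proof.
rewrite ev_bind; congr ev; apply/funext => -[[a u]|Z] //=.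
by case: eqP.
Qed.

Lemma ev_mu Y t phi :
  ev (mu Y t) phi =
  (1 - ev t (at_point (inr Y : A)))^-1 * ev t (fun x => match x with
    | inl (a, u) => phi (inl (a, subst u Y (mu Y t)))
    | inr Z => if Z == Y then 0 else phi (inr Z) end).
Proof.
rewrite /= !ev_rename; congr ((1 - ev t _)^-1 * ev t _).
  apply/funext => -[[a u]|Z] //=; rewrite /at_point.
  rewrite (_ : (inr Z == inr Y :> A) = (Z == Y)) //.
  by case: eqP.
apply/funext => -[[a u]|Z] /=; last by case: eqP.
rewrite -rename_bindE bind_rename; congr (phi (inl (a, bind _ u))).
by apply/funext => Z /=; case: eqP.
Qed.

Lemma eq_ev_bisim t s : ev t = ev s -> bisim t s.
Proof.
move=> ts; apply: (coinduction X_infinite lam01 (E := fun t s => ev t = ev s)) => //.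
by move=> {ts}t {}s ->.
Qed.

Lemma bisim_subst Y u t s : bisim t s -> bisim (subst t Y u) (subst s Y u).
Proof.
move=> ts.
pose E t s := exists t' s', [/\ bisim t' s', t = subst t' Y u & s = subst s' Y u].
apply: (coinduction X_infinite lam01 (E := E)); last by exists t, s.
move=> _ _ [t' [s' [ts' -> ->]]] phi phiE _; rewrite !ev_subst.
apply: (bisim_ev X_infinite lam01 ts') => a v w vw.
by apply: phiE; exists v, w.
Qed.

(** The transitions of [u] reach those of [m] and [m'] only through the name [Y], where the
    integrals of [phi] are compared by hypothesis; the other successors stay related by [E], and
    [phi] respects [E]. *)
Lemma bisim_contextual Y m m' :
  (forall phi, (forall a u, phi (inl (a, subst u Y m)) = phi (inl (a, subst u Y m'))) ->
     respects bisim phi -> ev m phi = ev m' phi) ->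
  bisim m m'.
Proof.
move=> mm'; pose E t s := exists u, t = subst u Y m /\ s = subst u Y m'.
apply: (coinduction X_infinite lam01 (E := E)); last first.
  by exists (Name Y); rewrite /subst /= eqxx.
move=> _ _ [u [-> ->]] phi phiE phiB; rewrite !ev_subst; congr ev.
have phi_m a v : phi (inl (a, subst v Y m)) = phi (inl (a, subst v Y m')).
  by apply: phiE; exists v.
by apply/funext => -[[a v]|Z] //; rewrite (mm' phi).
Qed.

(** Substituting [mu Y t] in successors preserves bisimilarity, so [t] may be replaced by [s] under
    the integral; the condition on [phi] in [bisim_contextual] then exchanges [mu Y t] for [mu Y s]
    in the successors. *)
Lemma bisim_mu Y t s : bisim t s -> bisim (mu Y t) (mu Y s).
Proof.
move=> ts; apply: (bisim_contextual (Y := Y)) => phi phiE phiB; rewrite !ev_mu.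
rewrite (bisim_ev X_infinite lam01 ts (phi := at_point _)) //.
congr (_ * _).
rewrite (bisim_ev X_infinite lam01 ts); last first.
  by move=> a u v uv; apply/phiB/bisim_subst.
by congr ev; apply/funext => -[[a u]|Z].
Qed.

(** With [q] the mass of [Y] in [t], adding the summand [Y] multiplies both the integral of the body
    and [1 - q] by [e], which cancels because [e > 0]. *)
Lemma bisim_unguard Y (e : {i01 R}) t : 0 < e%:num ->
  bisim (mu Y (Sum e t (Name Y))) (mu Y t).
Proof.
move=> e0; apply: (bisim_contextual (Y := Y)) => phi phiE phiB; rewrite !ev_mu.
rewrite [ev (Sum _ _ _) _]/= [X in _ * X = _]/= eqxx mulr0 addr0.
rewrite /at_point [in X in (_ - (_ + _ * X))^-1]eqxx mulr1 -/(at_point _).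
set q := ev t _; rewrite (_ : 1 - (e%:num * q + (1 - e%:num)) = e%:num * (1 - q)).
  rewrite invfM mulrACA mulVf ?gt_eqF // mul1r; congr (_ * _).
  by congr ev; apply/funext => -[[a u]|Z].
ring.
Qed.

(** A guarded name carries no mass in the transitions of [t]. *)
Lemma guarded_ev {N : Type} (Y : N) (t : term R L void N)
    (phi psi : L * term R L void N + N -> R) :
  guarded Y t -> (forall x, x <> inr Y -> phi x = psi x) -> ev t phi = ev t psi.
Proof.
elim: t Y phi psi => {N} [N v|N Z|N a t IH|N e t IHt s IHs|N t IH] Y phi psi //=.
- by move=> ZY; apply=> -[].
- by move=> _; apply.
- move=> [ht hs] pp; congr (_ + _).
    by case: ht => [->|/IHt/(_ pp) -> //]; rewrite !mul0r.
  by case: hs => [->|/IHs/(_ pp) -> //]; rewrite subrr !mul0r.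
- move=> gt pp; congr (_ * _); apply: IH gt _ => -[[a u]|[Z|]] //= ZY.
    by rewrite pp.
  by rewrite pp // => -[ZY']; apply: ZY; rewrite ZY'.
Qed.

(** Both sides integrate [phi] as [t] does after substituting the respective solution. The
    integrands agree on successors by the condition on [phi], and [Y] has no mass. *)
Lemma bisim_fix Y t s : guarded Y t -> bisim s (subst t Y s) -> bisim s (mu Y t).
Proof.
move=> gt st; apply: (bisim_contextual (Y := Y)) => phi phiE phiB.
have -> : ev (mu Y t) phi = ev (subst t Y (mu Y t)) phi.
  by rewrite subst_muE; apply/esym/ev_Rec.
rewrite (bisim_ev X_infinite lam01 st phiB) !ev_subst.
apply: guarded_ev gt _ => -[[a u]|Z] ZY //.
by case: eqP => // ZY'; case: ZY; rewrite ZY'.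
Qed.

Lemma discounted_distance_pref a t s : D (Pref a t) (Pref a s) <= lam * D t s.
Proof.
have l01 := pm_bounds (label_dist_pseudometric1 lam01 (discounted_distance_pm (L := L) X_infinite lam01)).
rewrite [leLHS](discounted_distanceE X_infinite lam01).
pose l : seq (R * (option A * option A)) :=
  [:: (1, (Some (inl (a, t)), Some (inl (a, s))))].
have lP : lcoupling (ev_star (Pref a t : T)) (ev_star (Pref a s : T)) l.
  split=> [|f|f]; first by rewrite /nneg /= ler01.
    by rewrite integ_cons integ_nil /ev_star /=; ring.
  by rewrite integ_cons integ_nil /ev_star /=; ring.
apply: le_trans (ot_le _ lP) _; first by move=> x y; have /andP[] := l01 x y.
by rewrite integ_cons integ_nil /cost /= eqxx mul1r addr0.
Qed.

Lemma discounted_distance_sum (e : {i01 R}) t t' s s' :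
  D (Sum e t t') (Sum e s s') <= e%:num * D t s + (1 - e%:num) * D t' s'.
Proof.
have l01 := pm_bounds (label_dist_pseudometric1 lam01 (discounted_distance_pm (L := L) X_infinite lam01)).
rewrite !(discounted_distanceE X_infinite lam01).
have mixE u u' : ev_star (Sum e u u' : T) = mixf e%:num (ev_star u) (ev_star u').
  by apply/funext => f; rewrite /ev_star /mixf /=; ring.
rewrite !mixE; apply: ot_mix; try exact: prob_ev_star.
  by move=> x y; have /andP[] := l01 x y.
by apply/andP.
Qed.

End Bisimilarity.

(** * Instantiation of metavariables by closed terms *)

Section ConstantInstantiation.
Context {R : realType} {L : Type}.

(** This measure is invariant under renaming, which permits induction through
    [Rec t = mu Y (rename f t)]. *)
Fixpoint tsize {V N : Type} (t : term R L V N) : nat :=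
  match t with
  | Cst _ | Name _ => 0
  | Pref _ t => (tsize t).+1
  | Sum _ t s => (tsize t + tsize s).+1
  | Rec t => (tsize t).+1
  end.

Lemma tsize_rename {V N M} (f : N -> M) (t : term R L V N) :
  tsize (rename f t) = tsize t.
Proof.
elim: t M f => {N} [N v|N Y|N a t IH|N e t IHt s IHs|N t IH] M f //=.
- by rewrite IH.
- by rewrite IHt IHs.
- by rewrite IH.
Qed.

Lemma guarded_rename {V N M} (f : N -> M) Y (t : term R L V N) :
  (forall Z, f Z <> Y) -> guarded Y (rename f t).
Proof.
elim: t M f Y => {N} [N v|N Z|N a t IH|N e t IHt s IHs|N t IH] M f Y //= fY.
- by split; right; [apply: IHt|apply: IHs].
- by apply: IH => -[Z|] //= [/fY].
Qed.

(* Closed terms are encoded as terms over the empty type of names. *)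
Fixpoint cinst {W V N : Type} (rho : W -> term R L V void) (t : term R L W N) :
    term R L V N :=
  match t with
  | Cst w => rename (of_void N) (rho w)
  | Name Y => Name Y
  | Pref a t => Pref a (cinst rho t)
  | Sum e t s => Sum e (cinst rho t) (cinst rho s)
  | Rec t => Rec (cinst rho t)
  end.

Context {W V : Type} (rho : W -> term R L V void).

Lemma cinst_rename {N M} (f : N -> M) (t : term R L W N) :
  cinst rho (rename f t) = rename f (cinst rho t).
Proof.
elim: t M f => {N} [N v|N Y|N a t IH|N e t IHt s IHs|N t IH] M f //=.
- by rewrite rename_comp; congr rename; apply/funext => -[].
- by rewrite IH.
- by rewrite IHt IHs.
- by rewrite IH.
Qed.

Lemma cinst_bind {N M} (f : N -> term R L W M) (t : term R L W N) :
  cinst rho (bind f t) = bind (cinst rho \o f) (cinst rho t).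
Proof.
elim: t M f => {N} [N v|N Y|N a t IH|N e t IHt s IHs|N t IH] M f //=.
- by rewrite bind_rename rename_bindE; congr bind; apply/funext => -[].
- by rewrite IH.
- by rewrite IHt IHs.
- rewrite IH; congr (Rec (bind _ _)); apply/funext => -[Y|] //=.
  by rewrite cinst_rename.
Qed.

Lemma cinst_mu {N : eqType} (Y : N) (t : term R L W N) :
  cinst rho (mu Y t) = mu Y (cinst rho t).
Proof. by rewrite /= cinst_rename. Qed.

Lemma cinst_subst {N : eqType} (Y : N) (t s : term R L W N) :
  cinst rho (subst t Y s) = subst (cinst rho t) Y (cinst rho s).
Proof.
rewrite /subst cinst_bind; congr bind; apply/funext => Z /=.
by case: eqP.
Qed.

Lemma guarded_cinst {N} (Y : N) (t : term R L W N) :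
  guarded Y t -> guarded Y (cinst rho t).
Proof.
elim: t Y => {N} [N v|N Z|N a t IH|N e t IHt s IHs|N t IH] Y //=.
- by move=> _; apply: guarded_rename => -[].
- by move=> [ht hs]; split; [case: ht|case: hs]; auto.
- exact: IH.
Qed.

Lemma cinst_map_cst {N} (t : term R L void N) (rho' : W -> term R L void void) :
  cinst rho' (map_cst (of_void W) t) = t.
Proof.
elim: t => {N} [N v|N Y|N a t IH|N e t IHt s IHs|N t IH] //=.
- by rewrite IH.
- by rewrite IHt IHs.
- by rewrite IH.
Qed.

End ConstantInstantiation.

(** * Homomorphic extensions of substitutions for metavariables *)

Section HomExtension.
Context {R : realType} {L X W : countType} (X_infinite : infinite_set [set: X]).
Local Notation T := (term R L W X).
Context {sigma : W -> T} {h : T -> T} (hP : hom_extension sigma h).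

(* mu X. w does not depend on X, so neither does mu X. (sigma w). *)
Lemma hom_extension_closed w Y : fresh Y (sigma w).
Proof.
have fin : finite_set ([set Z | ~ fresh Z (sigma w)] `|` [set Y]).
  by rewrite finite_setU; split; [exact: finite_not_fresh|exact: finite_set1].
have [Z ZP] : exists Z, ~ ([set Z | ~ fresh Z (sigma w)] `|` [set Y]) Z.
  apply: contrapT => h1; apply: X_infinite; apply: sub_finite_set fin => Z _.
  by apply: contrapT => hZ; apply: h1; exists Z.
have ZY : Z != Y by apply/eqP => ZY; apply: ZP; right.
have {ZP} Zf : fresh Z (sigma w) by apply: contrapT => hZ; apply: ZP; left.
have mu_w Y' : mu Y' (sigma w) = h (Rec (Cst w)).
  by rewrite -(hom_cst hP) -(hom_mu hP).
have : mu Y (sigma w) = mu Z (sigma w) by rewrite !mu_w.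
rewrite /mu => -[E].
have : fresh None (rename (fun V => if V == Z then None else Some V) (sigma w)).
  by apply/fresh_rename => V; case: eqP => // ->.
rewrite -E => /fresh_rename; apply.
by rewrite eqxx.
Qed.

(** Each [sigma w] is closed, hence comes from a term [c w] over the empty type of names, and [rho']
    sends [w] to [cinst rho (c w)]. This makes (Subst) a change of instantiation. *)
Lemma cinst_hom_extension (rho : W -> term R L void void) :
  exists rho' : W -> term R L void void, forall t, cinst rho (h t) = cinst rho' t.
Proof.
have /choice[c cP] : forall w, exists c, rename (of_void X) c = sigma w.
  move=> w; apply: rename_preimage => Y; case.
  exact: hom_extension_closed.
exists (fun w => cinst rho (c w)) => t.
(* The binder case passes to a renamed body, so the induction is on size. *)
move: {2}(tsize t) (leqnn (tsize t)) => n.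
elim: n t => [|n IH] [w|Y|a t|e t s|t] //=; rewrite ?ltnS => tn.
- by rewrite (hom_cst hP) -cP cinst_rename.
- by rewrite (hom_name hP).
- by rewrite (hom_cst hP) -cP cinst_rename.
- by rewrite (hom_name hP).
- by rewrite (hom_pref hP) /= IH.
- rewrite (hom_sum hP) /= !IH //; apply: leq_trans tn; rewrite ?leq_addr ?leq_addl //.
- have [Y [f tE]] := Rec_mu X_infinite t.
  by rewrite -tE (hom_mu hP) cinst_mu IH ?tsize_rename // -cinst_mu tE.
Qed.

End HomExtension.

(** * Soundness of the rules *)

Section Soundness.
Context {R : realType} {L X W : countType} (X_infinite : infinite_set [set: X]).
Context {lam : R} (lam01 : 0 < lam <= 1).
Local Notation Q := (qeq R L W X).
Local Notation D := (@discounted_distance R L X lam).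

Definition holds (rho : W -> term R L void void) (q : Q) : Prop :=
  D (cinst rho (qlhs q)) (cinst rho (qrhs q)) <= ratr (qerr q)%:num.

Lemma holds0 rho (t s : term R L W X) :
  holds rho (t =[ 0%:nng ]= s) <-> @bisimilar R L X lam (cinst rho t) (cinst rho s).
Proof.
have D01 := pm_bounds (discounted_distance_pm (L := L) X_infinite lam01).
rewrite /holds /bisimilar /= rmorph0; split=> [h|->//].
by apply/eqP; rewrite eq_le h; have /andP[] := D01 (cinst rho t) (cinst rho s).
Qed.

Lemma holds0_ev rho (t s : term R L W X) :
  (forall phi, ev (cinst rho t) phi = ev (cinst rho s) phi) ->
  holds rho (t =[ 0%:nng ]= s).
Proof.
move=> ts; apply/holds0; apply: (eq_ev_bisim X_infinite lam01).
exact/funext.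
Qed.

(** The claim covers all [rho] at once, since (Subst) passes to another instantiation, and keeps
    hypotheses, since (Cut) composes entailments. *)
Lemma derives_sound Gamma q : derives lam Gamma q ->
  forall rho, (forall r, Gamma r -> holds rho r) -> holds rho q.
Proof.
have [Dxx DC Dtri D01] := discounted_distance_pm (L := L) X_infinite lam01.
elim=> {Gamma q}.
- by move=> t rho _; rewrite /holds /= Dxx rmorph0.
- by move=> t s eps rho /(_ _ erefl); rewrite /holds /= DC.
- move=> t u s eps eps' rho h.
  have h1 := h _ (or_introl erefl); have h2 := h _ (or_intror erefl).
  rewrite /holds /= rmorphD; apply: le_trans (Dtri _ (cinst rho u) _) _.
  exact: lerD.
- move=> t s eps eps' eps'0 rho /(_ _ erefl); rewrite /holds /= => h.
  by apply: le_trans h _; rewrite ler_rat lerDl ltW.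
(* (Arch): if the distance exceeded [eps], a rational [q] strictly between them would contradict the
   hypothesis at [q]. *)
- move=> t s eps rho h; rewrite /holds /= leNgt; apply/negP => lt_eps.
  have [q] := rat_in_itvoo lt_eps; rewrite in_itv /= => /andP[eps_q q_D].
  rewrite ltr_rat in eps_q.
  have q0 : 0 <= q by apply: le_trans (ltW eps_q).
  have : holds rho (t =[ NngNum q0 ]= s) by apply: h; exists (NngNum q0).
  by rewrite /holds /= leNgt q_D.
- move=> sigma h Gamma q hP _ IH rho hG.
  have [rho' rhoE] := cinst_hom_extension X_infinite hP rho.
  rewrite /holds /map_qeq /= !rhoE; apply: (IH rho') => r Gr.
  by have := hG _ (ex_intro2 _ _ r Gr erefl); rewrite /holds /map_qeq /= !rhoE.
- by move=> Gamma Theta q _ IHT _ IH rho hG; apply: IH => r /IHT; apply.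
- by move=> Gamma q Gq rho; apply.
- by move=> t s rho _; apply: holds0_ev => phi /=; ring.
- by move=> e t rho _; apply: holds0_ev => phi /=; ring.
- by move=> e t s rho _; apply: holds0_ev => phi /=; ring.
(* (SA): the denominator [1 - e e'] is positive because [e e' <= e < 1]. *)
- move=> e e' f t s u e1 e'1 fE rho _; apply: holds0_ev => phi /=; rewrite fE.
  field; rewrite subr_eq0 gt_eqF //; apply: le_lt_trans e1.
  by apply: ler_piMr => //; exact: ltW.
- move=> Y t rho _; apply: holds0_ev => phi.
  by rewrite cinst_subst cinst_mu subst_muE; apply/esym/ev_Rec.
- move=> Y e t e0 rho _; apply/holds0; rewrite !cinst_mu.
  exact: (bisim_unguard X_infinite lam01).
- move=> Y t s gt rho /(_ _ erefl)/holds0; rewrite cinst_subst => st.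
  apply/holds0; rewrite cinst_mu; apply: (bisim_fix X_infinite lam01) => //.
  exact: guarded_cinst.
- move=> Y t s rho /(_ _ erefl)/holds0 ts; apply/holds0; rewrite !cinst_mu.
  exact: (bisim_mu X_infinite lam01).
- move=> t s rho _; rewrite /holds /= rmorph1.
  by have /andP[] := D01 (cinst rho t) (cinst rho s).
- move=> a t s eps rho /(_ _ erefl); rewrite /holds /= => h.
  apply: le_trans (discounted_distance_pref X_infinite lam01 _ _ _) _.
  apply: le_trans h; have /andP[_ lam1] := lam01.
  by apply: ler_piMl => //; have /andP[] := D01 (cinst rho t) (cinst rho s).
- move=> e t s t' s' eps eps' eps'' he rho h.
  have h1 := h _ (or_introl erefl); have h2 := h _ (or_intror erefl).
  rewrite /holds /=; apply: le_trans he.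
  apply: le_trans (discounted_distance_sum X_infinite lam01 _ _ _ _ _) _.
  by apply: lerD; apply: ler_wpM2l => //; rewrite subr_ge0.
- move=> a t s eps eps' he rho /(_ _ erefl); rewrite /holds /= => h.
  apply: le_trans (discounted_distance_pref X_infinite lam01 _ _ _) _.
  apply: le_trans he; have /andP[lam0 _] := lam01.
  by rewrite ler_wpM2l // ltW.
Qed.

End Soundness.

Theorem theorem6p3 (R : realType) (L X W : countType)
    (X_infinite : infinite_set [set: X]) (lam : R) (lam01 : 0 < lam <= 1)
    (t s : term R L void X) (eps : {nonneg rat}) :
  derives (W := W) lam set0
    (map_cst (of_void W) t =[ eps ]= map_cst (of_void W) s) ->
  discounted_distance lam t s <= ratr eps%:num.
Proof.
(* The embedded terms contain no metavariable, so the instantiation is arbitrary; the closed term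
   [mu X. X] is taken. *)
move=> /(derives_sound X_infinite lam01)/(_ (fun=> Rec (Name None))).
by rewrite /holds /= !cinst_map_cst; apply.
Qed.
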